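(* Let $W$ be a solvable Abstract Curve Combinatorics satisfying the Bézout Condition and let $\pi: W=W_0\leftarrow W_1\leftarrow\dots\leftarrow W_n=\widehat W$ be a resolution of $W$. Then any combinatorial pencil $\mathcal P_1=(\mathcal F_1,\bar m_1)$ of $W$ admits a primitive refinement with respect to $\pi$; that is, there exists a combinatorial pencil $\mathcal P_2=(\mathcal F_2,\bar m_2)$ of $W$ which is a refinement of $\mathcal P_1$ and is primitive with respect to $\pi$.
   Context: **ACC.** An Abstract Curve Combinatorics (ACC) is a sextuplet $W=(\mathbf r,S,\Delta,\partial,\phi,\mu)$ where $\mathbf r,S,\Delta$ are finite sets (components, points, branches), $\partial:\Delta\to S$ and $\phi:\Delta\to\mathbf r$ are surjective, and $\mu$ is a symmetric function on pairs of elements of $\Delta$ with values in $\mathbb{N}=\{0,1,2,\dots\}$ such that $\mu(\delta_1,\delta_2)>0$ iff $\partial(\delta_1)=\partial(\delta_2)$ and $\phi(\delta_1)\ne\phi(\delta_2)$. Put $\Delta_P:=\partial^{-1}(P)$. **Bézout Condition.** For $i\neq j$ in $\mathbf r$ let $d_{i,j}:=\sum_{\phi(\delta_1)=i,\ \phi(\delta_2)=j}\mu(\delta_1,\delta_2)$. $W$ satisfies the Bézout Condition if for each $i$ the quotient $d_{i,j}d_{i,k}/d_{j,k}$ is (defined and) independent of $j,k$ ($i,j,k$ pairwise distinct). Then the degree of $i$ is $d_i:=+\sqrt{d_{i,j}d_{i,k}/d_{j,k}}$. **Combinatorial pencil.** For $W$ satisfying the Bézout Condition, a combinatorial pencil of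 $W$ is a pair $(\mathcal F,\bar m)$ with $\bar m=(m_i)_{i\in\mathbf r}$ a list of positive integers and $\mathcal F=\{F_1,\dots,F_k\}$, $k\ge3$, a partition of $\mathbf r$ (its members are called fibers) such that: (1) $\sum_{i\in F_j}m_id_i$ is independent of $j$; (2) for any $P\in S$, either (a) $\phi(\Delta_P)\subset F_i$ for some $i$, or (b) $\phi(\Delta_P)$ is contained in no single $F_i$, and for each $\delta\in\Delta_P$ the number $\sum_{\delta'\in\Delta,\ \phi(\delta')\in F_j}m_{\phi(\delta')}\mu(\delta,\delta')$ is independent of $j$ among those $j$ with $\phi(\delta)\notin F_j$. **$\sigma$-process.** Given $P\in S$ and positive integers $\bar\nu=(\nu_\delta)_{\delta\in\Delta_P}$, an ACC $\widehat W=(\hat{\mathbf r},\hat S,\hat\Delta,\hat\partial,\hat\phi,\hat\mu)$ is obtained from $W$ by a $\sigma$-process at $P$ (written $W\leftarrow\widehat W$) if there is a partition $\{\hat P_1,\dots,\hat P_\ell\}$ of $\Delta_P$ such that: $\hat{\mathbf r}=\mathbf r\cup\{E\}$ with $E$ a new element (the exceptional divisor); $\hat S=(S\setminus\{P\})\cup\{\hat P_1,\dots,\hat P_\ell\}$; $\hat\Delta=\Delta\cup\{\hat\delta_1,\dots,\hat\delta_\ell\}$ with new branches satisfying $\hat\phi(\hat\delta_i)=E$, $\hat\partial(\hat\delta_i)=\hat P_i$; $\hat\phi|_\Delta=\phi$; $\hat\partial=\partial$ on $\Delta\setminus\Delta_P$ and $\hat\partial(\delta)=\hat P_i$ if $\delta\in\hat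 P_i$; $\hat\mu(\delta,\hat\delta_i)=\nu_\delta$ if $\delta\in\hat P_i$; $\hat\mu(\delta_1,\delta_2)=\mu(\delta_1,\delta_2)-\nu_{\delta_1}\nu_{\delta_2}$ if $\delta_1,\delta_2\in\Delta_P$ and $\phi(\delta_1)\ne\phi(\delta_2)$; and $\hat\mu=\mu$ on pairs of branches of $\Delta$ not both in $\Delta_P$. **Resolution.** A sequence of $\sigma$-processes $W=W_0\leftarrow W_1\leftarrow\dots\leftarrow W_n=\widehat W$ of ACCs $W_\ell=(\mathbf r^{(\ell)},S^{(\ell)},\Delta^{(\ell)},\partial^{(\ell)},\phi^{(\ell)},\mu^{(\ell)})$ is a resolution of $W$ if at every step $\nu_\delta\le1$ for each $\delta\notin\Delta^{(0)}$, $\#\Delta^{(n)}_P=2$ for every $P\in S^{(n)}$, and $\mu^{(n)}$ only takes values in $\{0,1\}$. $W$ is solvable if it has a resolution. **Admissible family and trivial divisors.** Let $(\mathcal F,\bar m)$ be a combinatorial pencil with fibers $F_0,\dots,F_k$. Its associated family in $\mathbb{Q}^k$ (canonical basis $e_1,\dots,e_k$) is $v_i=m_ie_j$ if $i\in F_j$ with $j\ne0$, and $v_i=-m_i(e_1+\dots+e_k)$ if $i\in F_0$. It is extended to the components of all $W_\ell$: at each $\sigma$-process at a point $P$ with multiplicities $\nu_\delta$, the new exceptional divisor gets $v_E:=\sum_{\delta\in\Delta_P}\nu_\delta v_{\phi(\delta)}$ (with $\Delta_P$ and $\phi$ of the ACC to which the $\sigma$-process is applied). An exceptional divisor $E$ is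 trivial (for the given pencil) if $v_E=0$; this does not depend on the numbering of the fibers. **Refinement.** A combinatorial pencil $\mathcal P_2=(\mathcal F_2,\bar m_2)$ of $W$ is a refinement of $\mathcal P_1=(\mathcal F_1,\bar m_1)$ if each fiber of $\mathcal P_2$ is contained in a fiber of $\mathcal P_1$. **Primitive.** Two components of an ACC intersect if there are branches of each with positive $\mu$. A combinatorial pencil $(\mathcal F,\bar m)$ is primitive with respect to $\pi$ if any two components in the same fiber of $\mathcal F$ can be connected in $\widehat W$ by a finite chain of consecutively intersecting components none of which is a trivial exceptional divisor (for that pencil), and $\gcd(\bar m)=1$. *)

(* Defs.v *)
From mathcomp Require Import all_boot all_order all_algebra.

Set Implicit Arguments.
Unset Strict Implicit.
Unset Printing Implicit Defensive.

Import Order.TTheory GRing.Theory Num.Theory.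
Local Open Scope ring_scope.

(* Abstract Curve Combinatorics (r, S, Delta, del, phi, mu): [br_pt] is del and
   [br_comp] is phi. *)
Record acc := Acc {
  components : finType;
  points : finType;
  branches : finType;
  br_pt : branches -> points;
  br_comp : branches -> components;
  mu : branches -> branches -> nat;
  br_pt_surj : forall P, exists b, br_pt b = P;
  br_comp_surj : forall i, exists b, br_comp b = i;
  mu_sym : forall b1 b2, mu b1 b2 = mu b2 b1;
  mu_gt0 : forall b1 b2,
    (0 < mu b1 b2)%N = (br_pt b1 == br_pt b2) && (br_comp b1 != br_comp b2)
}.

Definition branches_at (W : acc) (P : points W) : {set branches W} :=
  [set b | br_pt b == P].

Definition inter_num (W : acc) (i j : components W) : nat :=
  (\sum_(b1 | br_comp b1 == i) \sum_(b2 | br_comp b2 == j) mu b1 b2)%N.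

Definition bezout_quot (W : acc) (i j k : components W) : rat :=
  (inter_num i j)%:R * (inter_num i k)%:R / (inter_num j k)%:R.

(* The first clause says that all the quotients are defined. *)
Definition bezout (W : acc) : Prop :=
  (forall i j k : components W, uniq [:: i; j; k] -> inter_num j k <> 0%N) /\
  (forall i j k j' k' : components W,
     uniq [:: i; j; k] -> uniq [:: i; j'; k'] ->
     bezout_quot i j k = bezout_quot i j' k').

(* Under [bezout] the choice of (j, k) is irrelevant. The default 0 only occurs
   with fewer than three components, in which case there is no pencil. *)
Definition degree (R : rcfType) (W : acc) (i : components W) : R :=
  if [pick jk : components W * components W | uniq [:: i; jk.1; jk.2]]
    is Some jk
  then Num.sqrt (ratr (bezout_quot i jk.1 jk.2))
  else 0.

Definition fiber_inter (W : acc) (m : components W -> nat)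
    (F : {set components W}) (b : branches W) : nat :=
  (\sum_(b' | br_comp b' \in F) m (br_comp b') * mu b b')%N.

Record cpencil (R : rcfType) (W : acc) := CPencil {
  fibers : {set {set components W}};
  mult : components W -> nat;
  fibers_partition : partition fibers [set: components W];
  fibers_ge3 : (3 <= #|fibers|)%N;
  mult_gt0 : forall i, (0 < mult i)%N;
  fibers_degree : forall F G, F \in fibers -> G \in fibers ->
    \sum_(i in F) (mult i)%:R * degree R i =
    \sum_(i in G) (mult i)%:R * degree R i;
  fibers_local : forall P : points W,
    (exists2 F, F \in fibers & [set br_comp b | b in branches_at P] \subset F)
    \/
    ((forall F, F \in fibers ->
        ~~ ([set br_comp b | b in branches_at P] \subset F)) /\
     (forall b, b \in branches_at P ->
        forall F G, F \in fibers -> G \in fibers ->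
        br_comp b \notin F -> br_comp b \notin G ->
        fiber_inter mult F b = fiber_inter mult G b))
}.

Definition block (T : finType) (D : {set {set T}}) := {B : {set T} | B \in D}.

(* W <- W', with the set-theoretic identities on the components, points and
   branches of W' expressed by bijections: [sp_comp None] is the exceptional
   divisor E, [sp_pt (inr B)] the new point given by the block B of the
   partition of the branches at the centre, and [sp_br (inr B)] the new branch
   through that point. The values of [sp_nu] off the centre are irrelevant.
   The values of mu' left unspecified (such as those on two branches of the
   same component) are 0 because W' is an ACC. *)
Record sigma_process (W W' : acc) := SigmaProcess {
  sp_center : points W;
  sp_nu : branches W -> nat;
  sp_blocks : {set {set branches W}};
  sp_comp : option (components W) -> components W';
  sp_pt : {Q : points W | Q != sp_center} + block sp_blocks -> points W';
  sp_br : branches W + block sp_blocks -> branches W';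
  sp_nu_gt0 : forall b, b \in branches_at sp_center -> (0 < sp_nu b)%N;
  sp_blocksP : partition sp_blocks (branches_at sp_center);
  sp_comp_bij : bijective sp_comp;
  sp_pt_bij : bijective sp_pt;
  sp_br_bij : bijective sp_br;
  sp_br_comp_old : forall b,
    br_comp (sp_br (inl b)) = sp_comp (Some (br_comp b));
  sp_br_comp_new : forall B, br_comp (sp_br (inr B)) = sp_comp None;
  sp_br_pt_off : forall b Q, br_pt b = sval Q ->
    br_pt (sp_br (inl b)) = sp_pt (inl Q);
  sp_br_pt_center : forall b (B : block sp_blocks),
    b \in sval B -> br_pt (sp_br (inl b)) = sp_pt (inr B);
  sp_br_pt_new : forall B, br_pt (sp_br (inr B)) = sp_pt (inr B);
  sp_mu_new : forall b (B : block sp_blocks),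
    b \in sval B -> mu (sp_br (inl b)) (sp_br (inr B)) = sp_nu b;
  (* additive form, since subtraction on nat is truncated *)
  sp_mu_center : forall b1 b2,
    b1 \in branches_at sp_center -> b2 \in branches_at sp_center ->
    br_comp b1 != br_comp b2 ->
    (mu (sp_br (inl b1)) (sp_br (inl b2)) + sp_nu b1 * sp_nu b2)%N = mu b1 b2;
  sp_mu_off : forall b1 b2,
    ~~ ((b1 \in branches_at sp_center) && (b2 \in branches_at sp_center)) ->
    mu (sp_br (inl b1)) (sp_br (inl b2)) = mu b1 b2
}.

Arguments sp_pt [W W'] s _.
Arguments sp_br [W W'] s _.

Inductive sigma_seq (W : acc) : acc -> Type :=
| SigmaNil : sigma_seq W W
| SigmaRcons (W1 W2 : acc) :
    sigma_seq W W1 -> sigma_process W1 W2 -> sigma_seq W W2.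

Fixpoint seq_comp (W W' : acc) (s : sigma_seq W W') :
    components W -> components W' :=
  match s in sigma_seq _ W' return components W -> components W' with
  | SigmaNil => id
  | SigmaRcons _ _ s1 sp => fun i => sp_comp sp (Some (seq_comp s1 i))
  end.

Fixpoint seq_br (W W' : acc) (s : sigma_seq W W') :
    branches W -> branches W' :=
  match s in sigma_seq _ W' return branches W -> branches W' with
  | SigmaNil => id
  | SigmaRcons _ _ s1 sp => fun b => sp_br sp (inl (seq_br s1 b))
  end.

Fixpoint nu_new_le1 (W W' : acc) (s : sigma_seq W W') : Prop :=
  match s with
  | SigmaNil => True
  | SigmaRcons _ _ s1 sp =>
      nu_new_le1 s1 /\
      (forall b, b \in branches_at (sp_center sp) ->
         b \notin codom (seq_br s1) -> (sp_nu sp b <= 1)%N)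
  end.

Definition is_resolution (W W' : acc) (s : sigma_seq W W') : Prop :=
  [/\ nu_new_le1 s,
      forall P : points W', #|branches_at P| = 2 &
      forall b1 b2 : branches W', (mu b1 b2 <= 1)%N].

Definition solvable (W : acc) : Prop :=
  exists (W' : acc) (s : sigma_seq W W'), is_resolution s.

(* The family in Q^k of a pencil with k + 1 fibers F_0, ..., F_k, numbered
   according to [enum]; [delta_mx 0 j] is the basis vector e_(j+1). When i is
   not in F_0 the last sum has exactly one term. *)
Definition pencil_family (R : rcfType) (W : acc) (p : cpencil R W)
    (i : components W) : 'rV[rat]_(#|fibers p|.-1) :=
  let F j := nth set0 (enum (fibers p)) j in
  if i \in F 0%N then - (mult p i)%:R *: \sum_j delta_mx 0 j
  else \sum_(j < #|fibers p|.-1 | i \in F j.+1) (mult p i)%:R *: delta_mx 0 j.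

Definition extend_family (V : zmodType) (W W' : acc) (sp : sigma_process W W')
    (v : components W -> V) (i' : components W') : V :=
  if [pick i | sp_comp sp (Some i) == i'] is Some i then v i
  else \sum_(b in branches_at (sp_center sp)) v (br_comp b) *+ sp_nu sp b.

Fixpoint seq_family (V : zmodType) (W W' : acc) (s : sigma_seq W W')
    (v : components W -> V) : components W' -> V :=
  match s in sigma_seq _ W' return components W' -> V with
  | SigmaNil => v
  | SigmaRcons _ _ s1 sp => extend_family sp (seq_family s1 v)
  end.

Definition exceptional (W W' : acc) (s : sigma_seq W W')
    (i' : components W') : bool :=
  i' \notin codom (seq_comp s).

Definition trivial_exceptional (R : rcfType) (W W' : acc) (s : sigma_seq W W')
    (p : cpencil R W) (i' : components W') : bool :=
  exceptional s i' && (seq_family s (pencil_family p) i' == 0).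

Definition intersect (W : acc) : rel (components W) :=
  fun i j => [exists b1, exists b2,
    [&& br_comp b1 == i, br_comp b2 == j & (0 < mu b1 b2)%N]].

Definition refinement (R : rcfType) (W : acc) (p2 p1 : cpencil R W) : Prop :=
  forall F2, F2 \in fibers p2 -> exists2 F1, F1 \in fibers p1 & F2 \subset F1.

Definition primitive (R : rcfType) (W W' : acc) (s : sigma_seq W W')
    (p : cpencil R W) : Prop :=
  (forall F i j, F \in fibers p -> i \in F -> j \in F ->
     exists c : seq (components W'),
       [/\ path (@intersect W') (seq_comp s i) c,
           last (seq_comp s i) c = seq_comp s j &
           all (fun x => ~~ trivial_exceptional s p x) (seq_comp s i :: c)]) /\
  (\big[gcdn/0%N]_i mult p i = 1)%N.

(* Main.v *)
Require Import Defs.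
From mathcomp Require Import all_boot all_order all_algebra.
From mathcomp Require Import ring lra zify.

Set Implicit Arguments.
Unset Strict Implicit.
Unset Printing Implicit Defensive.

Import Order.TTheory GRing.Theory Num.Theory.
Local Open Scope ring_scope.

(** Blow-ups are encoded by an intersection form on the components of the
    resolution ([seq_form]): components of [W] get their degree squared as
    self-intersection, and each sigma-process adds a class of square -1. Three
    properties of surfaces survive in this combinatorial setting: the index
    theorem ([seq_form_hodge]), the independence of the exceptional divisors
    ([seq_form_exc_nondegenerate]), and the fact that the total transforms of
    two divisors of the same degree are numerically equivalent
    ([seq_form_total_transform]). The proof then follows the geometric one: the
    fibers of a pencil become disjoint isotropic divisors of the resolution, and
    their connected components, suitably weighted, are the fibers of the
    refinement.

    The first difficulty is that the fibers are disjoint at all: an exceptional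
    divisor has a multiplicity [M j] in the total transform of every fiber [j],
    and it must be shown that all of them but one agree ([exceptional_peak]).
    The total transforms being equivalent, the differences of the [M j] solve a
    Dirichlet problem on the exceptional graph. The local condition on pencils
    survives blow-ups ([branch_inter_seq_family]) and in a resolution says that
    at a neighbour of a component of the fiber [j] all the other multiplicities
    agree. As the multiplicities along exceptional branches are at most 1, the
    exceptional graph is a forest ([exceptional_forest]), and eliminating its
    leaves one after the other ([forest_harmonic_peak]) propagates this property
    to all vertices.

    Removing the common part of the fibers leaves disjoint divisors, orthogonal
    to their own components. Each connected component of one of them is hence
    isotropic and orthogonal to the others; it contains a component of [W],
    because the form is definite on exceptional divisors
    ([component_degree_gt0]), and by the index theorem any two are proportional
    up to numerical equivalence ([component_proportional]). Rescaling them to a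
    common degree gives the new multiplicities. Comparing, on the resolution,
    the new total transforms with the rescaled components
    ([refined_multiplicity]) yields both the local condition for the new pencil
    ([refined_local]) and the nontriviality of the exceptional divisors inside
    its fibers ([refined_nontrivial]), along which the chains required by
    primitivity run. The degrees are commensurable by the Bezout condition
    ([degree_scale]), so the multiplicities can be taken integral and coprime. *)

(** * Intersection numbers under a sigma-process *)

Lemma mu_same_comp (W : acc) (b1 b2 : branches W) :
  br_comp b1 = br_comp b2 -> mu b1 b2 = 0%N.
Proof. by move=> e; apply/eqP; rewrite eqn0Ngt mu_gt0 e eqxx andbF. Qed.

Lemma mu_diff_pt (W : acc) (b1 b2 : branches W) :
  br_pt b1 != br_pt b2 -> mu b1 b2 = 0%N.
Proof. by move=> e; apply/eqP; rewrite eqn0Ngt mu_gt0 (negPf e). Qed.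

Lemma inter_num_sym (W : acc) (x y : components W) :
  inter_num x y = inter_num y x.
Proof.
rewrite /inter_num exchange_big /=; apply: eq_bigr => b _.
by apply: eq_bigr => b2 _; rewrite mu_sym.
Qed.

Lemma inter_num_self (W : acc) (x : components W) : inter_num x x = 0%N.
Proof.
rewrite /inter_num big1 // => b /eqP bx; rewrite big1 // => b' /eqP b'x.
by rewrite mu_same_comp // bx b'x.
Qed.

Lemma inter_num_gt0P (W : acc) (x y : components W) :
  reflect (exists b1 b2, [/\ br_comp b1 = x, br_comp b2 = y & (0 < mu b1 b2)%N])
    (0 < inter_num x y)%N.
Proof.
apply: (iffP idP) => [|[b1 [b2 [<- <- mu0]]]]; last first.
  by rewrite /inter_num (bigD1 b1) //= (bigD1 b2) //=; lia.
rewrite lt0n sum_nat_eq0 => /forallPn[b1]; rewrite negb_imply => /andP[/eqP b1x].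
rewrite sum_nat_eq0 => /forallPn[b2]; rewrite negb_imply => /andP[/eqP b2y].
by rewrite -lt0n; exists b1, b2.
Qed.

Section SigmaProcess.
Variables (W W' : acc) (sp : sigma_process W W').
Implicit Types (x y : components W) (b : branches W).

Local Notation P := (sp_center sp).
Local Notation nu := (sp_nu sp).
Local Notation E := (sp_comp sp None).
Local Notation old x := (sp_comp sp (Some x)).

Lemma sp_comp_inj : injective (sp_comp sp).
Proof. exact: bij_inj (sp_comp_bij sp). Qed.

Lemma sp_comp_eq (x y : option (components W)) :
  (sp_comp sp x == sp_comp sp y) = (x == y).
Proof. exact: inj_eq sp_comp_inj _ _. Qed.

Lemma sp_compP (T : components W' -> Prop) :
  T E -> (forall x, T (old x)) -> forall x' : components W', T x'.
Proof.
move=> T0 T1 x'; have [g gK Kg] := sp_comp_bij sp.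
by rewrite -(Kg x'); case: (g x').
Qed.

Lemma sp_brP (T : branches W' -> Prop) :
  (forall b, T (sp_br sp (inl b))) -> (forall B, T (sp_br sp (inr B))) ->
  forall b' : branches W', T b'.
Proof.
move=> T0 T1 b'; have [g gK Kg] := sp_br_bij sp.
by rewrite -(Kg b'); case: (g b').
Qed.

Lemma sum_sp_comp (V : nmodType) (F : components W' -> V) :
  \sum_(x' : components W') F x' = F E + \sum_x F (old x).
Proof.
rewrite (reindex (sp_comp sp)); last exact/onW_bij/sp_comp_bij.
rewrite (bigD1 None) //=; congr (_ + _).
rewrite (reindex_omap Some id) /=; last by case.
by apply: eq_bigl => x; rewrite eqxx.
Qed.

Lemma sum_sp_br (F : branches W' -> nat) (C : pred (branches W')) :
  (\sum_(b' | C b') F b' =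
   \sum_(b | C (sp_br sp (inl b))) F (sp_br sp (inl b)) +
   \sum_(B | C (sp_br sp (inr B))) F (sp_br sp (inr B)))%N.
Proof.
rewrite (reindex (sp_br sp)); last exact/onW_bij/sp_br_bij.
by rewrite big_sumType.
Qed.

Lemma sp_block_center (B : block (sp_blocks sp)) b :
  b \in sval B -> b \in branches_at P.
Proof.
move=> bB; rewrite -(cover_partition (sp_blocksP sp)).
by apply/bigcupP; exists (sval B) => //; exact: valP.
Qed.

Lemma sp_block_exists b :
  b \in branches_at P -> exists B : block (sp_blocks sp), b \in sval B.
Proof.
rewrite -(cover_partition (sp_blocksP sp)) => /bigcupP[B BB bB].
by exists (exist _ B BB).
Qed.

Lemma sp_block_uniq (B B' : block (sp_blocks sp)) b :
  b \in sval B -> b \in sval B' -> B = B'.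
Proof.
move=> bB bB'; apply: val_inj => /=.
have tI := partition_trivIset (sp_blocksP sp).
by rewrite -(def_pblock tI (valP B) bB) -(def_pblock tI (valP B') bB').
Qed.

Lemma mu_sp_newE b (B : block (sp_blocks sp)) :
  mu (sp_br sp (inl b)) (sp_br sp (inr B)) = if b \in sval B then nu b else 0%N.
Proof.
case: ifP => [/sp_mu_new //|/negbT bB]; apply: mu_diff_pt.
rewrite sp_br_pt_new; have [bP|bP] := boolP (b \in branches_at P).
  have [B' bB'] := sp_block_exists bP.
  rewrite (sp_br_pt_center bB') (inj_eq (bij_inj (sp_pt_bij sp))).
  by apply: contraNneq bB => -[<-].
rewrite inE in bP.
rewrite (@sp_br_pt_off _ _ sp b (exist _ (br_pt b) bP)) //.
by rewrite (inj_eq (bij_inj (sp_pt_bij sp))).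
Qed.

Lemma sum_mu_sp_new b :
  (\sum_B mu (sp_br sp (inl b)) (sp_br sp (inr B)) =
   if b \in branches_at P then nu b else 0)%N.
Proof.
case: ifP => bP.
  have [B bB] := sp_block_exists bP.
  rewrite (bigD1 B) //= mu_sp_newE bB big1 ?addn0 // => B' neq.
  rewrite mu_sp_newE ifF //; apply: contraNF neq => bB'.
  by rewrite (sp_block_uniq bB bB').
rewrite big1 // => B _; rewrite mu_sp_newE ifF //.
by apply: contraFF bP; apply: sp_block_center.
Qed.

(** What intersection numbers of components retain of [sp_nu]: the
    multiplicities of the branches of one component add up. *)
Definition comp_nu x : nat :=
  (\sum_(b in branches_at P | br_comp b == x) sp_nu sp b)%N.

Lemma comp_nu_gt0P x :
  reflect (exists2 b, b \in branches_at P & br_comp b = x) (0 < comp_nu x)%N.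
Proof.
apply: (iffP idP) => [|[b bP <-]]; last first.
  by rewrite /comp_nu (bigD1 b) ?bP ?eqxx //= addn_gt0 sp_nu_gt0.
rewrite lt0n sum_nat_eq0 => /forallPn[b]; rewrite negb_imply.
by case/andP => /andP[bP /eqP bx] _; exists b.
Qed.

Lemma sum_comp_nu (V : zmodType) (v : components W -> V) :
  \sum_(b in branches_at P) v (br_comp b) *+ nu b = \sum_x v x *+ comp_nu x.
Proof.
rewrite (partition_big (@br_comp W) xpredT) //=; apply: eq_bigr => x _.
by rewrite -sumrMnr; apply: eq_bigr => b /andP[_ /eqP->].
Qed.

Lemma extend_family_old (V : zmodType) (v : components W -> V) x :
  extend_family sp v (old x) = v x.
Proof.
rewrite /extend_family; case: pickP => [y /eqP/sp_comp_inj[->]//|/(_ x)].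
by rewrite eqxx.
Qed.

Lemma extend_family_new (V : zmodType) (v : components W -> V) :
  extend_family sp v E = \sum_x v x *+ comp_nu x.
Proof.
rewrite /extend_family; case: pickP => [y /eqP/sp_comp_inj//|_].
exact: sum_comp_nu.
Qed.

Lemma inter_num_new x : inter_num (old x) E = comp_nu x.
Proof.
rewrite /inter_num sum_sp_br /= [X in (_ + X)%N]big1 ?addn0; last first.
  by move=> B; rewrite sp_br_comp_new sp_comp_eq.
rewrite /comp_nu big_mkcondl /=; apply: eq_big => [b|b _].
  by rewrite sp_br_comp_old sp_comp_eq.
rewrite sum_sp_br /= big1 ?add0n; last first.
  by move=> b'; rewrite sp_br_comp_old sp_comp_eq.
rewrite -sum_mu_sp_new; apply: eq_bigl => B.
by rewrite sp_br_comp_new eqxx.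
Qed.

Lemma inter_num_old x y : x != y ->
  (inter_num (old x) (old y) + comp_nu x * comp_nu y)%N = inter_num x y.
Proof.
move=> xy; have inl_only z (F : branches W' -> nat) :
    (\sum_(b' | br_comp b' == old z) F b' =
     \sum_(b | br_comp b == z) F (sp_br sp (inl b)))%N.
  rewrite sum_sp_br /= addnC big1 ?add0n.
    by apply: eq_bigl => b; rewrite sp_br_comp_old sp_comp_eq.
  by move=> B; rewrite sp_br_comp_new sp_comp_eq.
rewrite /inter_num inl_only /comp_nu !big_mkcondl big_distrl /= -big_split /=.
apply: eq_bigr => b1 /eqP b1x; rewrite inl_only big_distrr -big_split /=.
apply: eq_bigr => b2 /eqP b2y.
have [b1P|b1P] := boolP (b1 \in branches_at P); last first.
  by rewrite mul0n addn0 sp_mu_off // (negPf b1P).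
have [b2P|b2P] := boolP (b2 \in branches_at P); last first.
  by rewrite muln0 addn0 sp_mu_off // (negPf b2P) andbF.
by rewrite sp_mu_center // b1x b2y.
Qed.

Lemma inter_num_old_le x y : (inter_num (old x) (old y) <= inter_num x y)%N.
Proof.
have [->|xy] := eqVneq x y; first by rewrite !inter_num_self.
by rewrite -(inter_num_old xy) leq_addr.
Qed.

End SigmaProcess.

(** * Exceptional components and families along a sequence of sigma-processes *)

Section SigmaSeq.
Variables (W W1 W2 : acc) (s : sigma_seq W W1) (sp : sigma_process W1 W2).

Lemma exceptional_seq_comp i : exceptional s (seq_comp s i) = false.
Proof. by rewrite /exceptional codom_f. Qed.

Lemma exceptionalPn x : ~~ exceptional s x -> exists i, x = seq_comp s i.
Proof. by rewrite negbK => /codomP[i ->]; exists i. Qed.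

Lemma exceptional_new : exceptional (SigmaRcons s sp) (sp_comp sp None).
Proof. by apply/codomP => -[i /= /sp_comp_inj]. Qed.

Lemma exceptional_old x :
  exceptional (SigmaRcons s sp) (sp_comp sp (Some x)) = exceptional s x.
Proof.
rewrite /exceptional; congr (~~ _).
apply/codomP/codomP => -[i /= e]; exists i; last by rewrite e.
exact/Some_inj/(sp_comp_inj e).
Qed.

End SigmaSeq.

Lemma exceptional_nil (W : acc) (x : components W) :
  exceptional (SigmaNil W) x = false.
Proof. exact: (exceptional_seq_comp (SigmaNil W) x). Qed.

Lemma br_comp_seq_br (W W' : acc) (s : sigma_seq W W') b :
  br_comp (seq_br s b) = seq_comp s (br_comp b).
Proof. by elim: s => [|W1 W2 s IH sp] //=; rewrite sp_br_comp_old IH. Qed.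

(** A sigma-process puts all its new branches on the exceptional divisor. *)
Lemma br_comp_seq_compP (W W' : acc) (s : sigma_seq W W') b' i :
  br_comp b' = seq_comp s i -> exists2 b, b' = seq_br s b & br_comp b = i.
Proof.
elim: s b' => [|W1 W2 s IH sp] /=; first by move=> b' <-; exists b'.
apply: (@sp_brP _ _ sp) => [b|B].
  by rewrite sp_br_comp_old => /sp_comp_inj[/IH[b0 -> <-]]; exists b0.
by rewrite sp_br_comp_new => /sp_comp_inj.
Qed.

Lemma seq_family_comp (V : zmodType) (W W' : acc) (s : sigma_seq W W')
    (v : components W -> V) i :
  seq_family s v (seq_comp s i) = v i.
Proof. by elim: s => [|W1 W2 s IH sp] //=; rewrite extend_family_old. Qed.

Lemma eq_seq_family (V : zmodType) (W W' : acc) (s : sigma_seq W W')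
    (v v' : components W -> V) :
  v =1 v' -> seq_family s v =1 seq_family s v'.
Proof.
move=> e; elim: s => [|W1 W2 s IH sp] //=.
apply: (@sp_compP _ _ sp) => [|x]; last by rewrite !extend_family_old IH.
by rewrite !extend_family_new; apply: eq_bigr => x _; rewrite IH.
Qed.

Lemma seq_familyB (V : zmodType) (W W' : acc) (s : sigma_seq W W')
    (v v' : components W -> V) x :
  seq_family s (fun i => v i - v' i) x = seq_family s v x - seq_family s v' x.
Proof.
elim: s x => [|W1 W2 s IH sp] //=; apply: (@sp_compP _ _ sp) => [|x].
  rewrite !extend_family_new -sumrB; apply: eq_bigr => x _.
  by rewrite IH mulrnBl.
by rewrite !extend_family_old IH.
Qed.

Lemma seq_family_morph (U V : zmodType) (g : U -> V) (W W' : acc)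
    (s : sigma_seq W W') (v : components W -> U) x :
    g 0 = 0 -> {morph g : u1 u2 / u1 + u2} ->
  g (seq_family s v x) = seq_family s (fun i => g (v i)) x.
Proof.
move=> g0 gD; have gMn u n : g (u *+ n) = g u *+ n.
  by elim: n => [|n IH]; rewrite ?mulr0n // !mulrS gD IH.
elim: s x => [|W1 W2 s IH sp] //=; apply: (@sp_compP _ _ sp) => [|x].
  rewrite !extend_family_new (big_morph g gD g0); apply: eq_bigr => x _.
  by rewrite gMn IH.
by rewrite !extend_family_old IH.
Qed.

Section BranchInter.
Variable V : zmodType.

(** The local intersection number of the divisor [\sum_x v x * x] with [b]. It
    is meaningful when the component of [b] has coefficient 0, as [mu] does not
    record self-intersections; hence the hypotheses [v (br_comp b) = 0] below. *)
Definition branch_inter (W : acc) (v : components W -> V) (b : branches W) : V :=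
  \sum_b' v (br_comp b') *+ mu b b'.

Lemma branch_inter_extend (W W' : acc) (sp : sigma_process W W')
    (v : components W -> V) b : v (br_comp b) = 0 ->
  branch_inter (extend_family sp v) (sp_br sp (inl b)) = branch_inter v b.
Proof.
move=> vb; rewrite /branch_inter (reindex (sp_br sp)) /=; last first.
  exact/onW_bij/sp_br_bij.
rewrite big_sumType /=.
under [X in _ + X]eq_bigr do rewrite sp_br_comp_new.
rewrite sumrMnr sum_mu_sp_new extend_family_new -sum_comp_nu.
under eq_bigr do rewrite sp_br_comp_old extend_family_old.
case: ifP => bP; last first.
  by rewrite addr0; apply: eq_bigr => b' _; rewrite sp_mu_off // bP.
rewrite -sumrMnl [X in _ + X]big_mkcond -big_split; apply: eq_bigr => b' _ /=.
case: ifP => [b'P|b'P]; last by rewrite addr0 sp_mu_off // b'P andbF.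
have [e|neq] := eqVneq (br_comp b') (br_comp b).
  by rewrite e vb !mul0rn addr0.
by rewrite -mulrnA -mulrnDr [(sp_nu sp b' * _)%N]mulnC sp_mu_center // eq_sym.
Qed.

(** Projection formula: a branch regains from each new exceptional divisor the
    intersection that it loses with the strict transforms. *)
Lemma branch_inter_seq_family (W W' : acc) (s : sigma_seq W W')
    (v : components W -> V) b : v (br_comp b) = 0 ->
  branch_inter (seq_family s v) (seq_br s b) = branch_inter v b.
Proof.
move=> vb; elim: s => [|W1 W2 s IH sp] //=.
by rewrite branch_inter_extend // br_comp_seq_br seq_family_comp.
Qed.

(** Once every point carries two branches, a branch meets a single other one. *)
Lemma branch_inter_normal_crossing (W : acc) (v : components W -> V)
    (b b' : branches W) :
    (forall P : points W, #|branches_at P| = 2) ->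
    (forall b1 b2 : branches W, (mu b1 b2 <= 1)%N) ->
  (0 < mu b b')%N -> branch_inter v b = v (br_comp b').
Proof.
move=> two le1 mu0; have := mu0; rewrite mu_gt0 => /andP[/eqP pt cmp].
have mu1 : mu b b' = 1%N by apply/eqP; rewrite eqn_leq le1.
rewrite /branch_inter (bigD1 b') //= mu1 mulr1n big1 ?addr0 // => b2 b2b'.
have [e|b2b] := eqVneq b2 b; first by rewrite e mu_same_comp.
rewrite mu_diff_pt //; apply: contra_eqN (two (br_pt b)) => /eqP pt2.
have sub : [set b; b'; b2] \subset branches_at (br_pt b).
  by apply/subsetP => c; rewrite !inE => /orP[/orP[]|] /eqP->; rewrite -?pt -?pt2.
rewrite gtn_eqF //; apply: leq_trans (subset_leq_card sub).
have neq : b != b' by apply: contraNneq cmp => ->.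
by rewrite setUC cardsU1 cards2 !inE negb_or b2b b2b' neq.
Qed.

End BranchInter.

(** * The intersection form *)

Section IntersectionForm.
Variable R : realFieldType.

Definition form_app (T : finType) (Q : T -> T -> R) (f : T -> R) (x : T) : R :=
  \sum_y Q x y * f y.

Definition form_sq (T : finType) (Q : T -> T -> R) (f : T -> R) : R :=
  \sum_x f x * form_app Q f x.

(** Strict transforms lose their multiplicity at the centre times the class of
    the exceptional divisor, which has self-intersection -1. *)
Definition blow_form (W W' : acc) (sp : sigma_process W W')
    (Q : components W -> components W -> R) (x' y' : components W') : R :=
  match [pick x | sp_comp sp (Some x) == x'],
        [pick y | sp_comp sp (Some y) == y'] with
  | Some x, Some y => Q x y - (comp_nu sp x)%:R * (comp_nu sp y)%:R
  | Some x, None => (comp_nu sp x)%:R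
  | None, Some y => (comp_nu sp y)%:R
  | None, None => - 1
  end.

(** The intersection matrix of the components of [W'], provided [d i * d j] is
    the intersection number of [i] and [j] in [W]; it gives the components of
    [W] the self-intersections [d i ^+ 2], as for plane curves. *)
Fixpoint seq_form (W W' : acc) (s : sigma_seq W W') (d : components W -> R) :
    components W' -> components W' -> R :=
  match s in sigma_seq _ W' return components W' -> components W' -> R with
  | SigmaNil => fun i j => d i * d j
  | SigmaRcons _ _ s1 sp => blow_form sp (seq_form s1 d)
  end.

Lemma eq_form_app (T : finType) (Q : T -> T -> R) f g x :
  f =1 g -> form_app Q f x = form_app Q g x.
Proof. by move=> e; apply: eq_bigr => y _; rewrite e. Qed.

Lemma form_appB (T : finType) (Q : T -> T -> R) f g x :
  form_app Q (fun y => f y - g y) x = form_app Q f x - form_app Q g x.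
Proof. by rewrite -sumrB; apply: eq_bigr => y _; rewrite mulrBr. Qed.

Lemma form_appZ (T : finType) (Q : T -> T -> R) c f x :
  form_app Q (fun y => c * f y) x = c * form_app Q f x.
Proof. by rewrite mulr_sumr; apply: eq_bigr => y _; rewrite mulrCA. Qed.

Section BlowForm.
Variables (W W' : acc) (sp : sigma_process W W').
Variable Q : components W -> components W -> R.
Local Notation E := (sp_comp sp None).
Local Notation old x := (sp_comp sp (Some x)).
Local Notation nu x := ((comp_nu sp x)%:R : R).

Lemma pick_old x : [pick y | old y == old x] = Some x.
Proof.
by case: pickP => [y /eqP/sp_comp_inj[->]//|/(_ x)]; rewrite eqxx.
Qed.

Lemma pick_new : [pick y | old y == E] = None.
Proof. by case: pickP => // y /eqP/sp_comp_inj. Qed.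

Definition blow_formE := (pick_old, pick_new).

(** The intersection number of the exceptional divisor with the divisor [g]. *)
Definition exc_inter (g : components W' -> R) : R :=
  \sum_y g (old y) *+ comp_nu sp y - g E.

Lemma blow_form_app_new g : form_app (blow_form sp Q) g E = exc_inter g.
Proof.
rewrite /form_app (sum_sp_comp sp) /blow_form !blow_formE /exc_inter addrC mulN1r.
by congr (_ - _); apply: eq_bigr => y _; rewrite !blow_formE mulr_natl.
Qed.

Lemma blow_form_app_old g x :
  form_app (blow_form sp Q) g (old x) =
  form_app Q (fun y => g (old y)) x - nu x * exc_inter g.
Proof.
rewrite /form_app (sum_sp_comp sp) /blow_form !blow_formE /exc_inter mulrBr opprB.
rewrite addrCA mulr_sumr -sumrB; congr (_ + _); apply: eq_bigr => y _.
by rewrite !blow_formE -[g _ *+ _]mulr_natl mulrBl mulrA.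
Qed.

Lemma blow_form_sq g :
  form_sq (blow_form sp Q) g =
  form_sq Q (fun y => g (old y)) - exc_inter g ^+ 2.
Proof.
rewrite /form_sq (sum_sp_comp sp) blow_form_app_new.
under eq_bigr do rewrite blow_form_app_old mulrBr mulrA mulr_natr.
rewrite sumrB -mulr_suml addrCA; congr (_ + _).
by rewrite -mulrBl -opprB mulNr -expr2.
Qed.

End BlowForm.

Variables (W : acc) (d : components W -> R).

Lemma seq_form_inter (W' : acc) (s : sigma_seq W W') x y :
    (forall i j, i != j -> d i * d j = (inter_num i j)%:R) ->
  x != y -> seq_form s d x y = (inter_num x y)%:R.
Proof.
move=> dP; elim: s x y => [|W1 W2 s IH sp] /= x' y'; first exact: dP.
elim/(@sp_compP _ _ sp): x' y' => [|x]; apply: (@sp_compP _ _ sp) => [|y].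
- by rewrite eqxx.
- by rewrite inter_num_sym inter_num_new /blow_form !blow_formE.
- by rewrite inter_num_new /blow_form !blow_formE.
rewrite sp_comp_eq /blow_form !blow_formE => xy; rewrite (IH _ _ xy).
by rewrite -(inter_num_old sp xy) natrD natrM addrK.
Qed.

(** Index theorem: each blow-up subtracts from the square of a divisor the
    square of its intersection number with the new exceptional divisor, so the
    degree squared remains the only positive part. *)
Lemma seq_form_hodge (W' : acc) (s : sigma_seq W W') f :
    \sum_i d i * f (seq_comp s i) = 0 ->
  form_sq (seq_form s d) f <= 0 /\
  (form_sq (seq_form s d) f = 0 -> forall x, form_app (seq_form s d) f x = 0).
Proof.
elim: s f => [|W1 W2 s IH sp] /= f deg0.
  have app0 x : form_app (fun i j => d i * d j) f x = 0.
    rewrite /form_app; under eq_bigr do rewrite -mulrA.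
    by rewrite -mulr_sumr deg0 mulr0.
  by split=> //; rewrite /form_sq big1 // => x _; rewrite app0 mulr0.
have [le0 eq0] := IH (fun x => f (sp_comp sp (Some x))) deg0.
rewrite blow_form_sq; have sq0 := sqr_ge0 (exc_inter sp f).
split=> [|q0]; first lra.
have /eqP : exc_inter sp f ^+ 2 = 0 by lra.
have /eq0{}eq0 : form_sq (seq_form s d) (fun x => f (sp_comp sp (Some x))) = 0 by lra.
rewrite sqrf_eq0 => /eqP ef0.
apply: (@sp_compP _ _ sp) => [|x]; first by rewrite blow_form_app_new.
by rewrite blow_form_app_old eq0 ef0 mulr0 subr0.
Qed.

(** Independence of the exceptional divisors: the vanishing of the intersection
    number with the last one reduces the claim to the previous stage. *)
Lemma seq_form_exc_nondegenerate (W' : acc) (s : sigma_seq W W') f :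
    (forall i, f (seq_comp s i) = 0) ->
    (forall x, exceptional s x -> form_app (seq_form s d) f x = 0) ->
  forall x, f x = 0.
Proof.
elim: s f => [|W1 W2 s IH sp] //= f f0 app0.
have e0 : exc_inter sp f = 0.
  by rewrite -(blow_form_app_new sp (seq_form s d)) app0 // exceptional_new.
have fold0 : forall x, f (sp_comp sp (Some x)) = 0.
  apply: (IH (fun x => f (sp_comp sp (Some x)))) => // x xE.
  have := app0 (sp_comp sp (Some x)); rewrite exceptional_old => /(_ xE).
  by rewrite blow_form_app_old e0 mulr0 subr0.
apply: (@sp_compP _ _ sp) => [|x //]; apply/eqP; rewrite -oppr_eq0 -e0.
by rewrite /exc_inter big1 ?add0r // => x _; rewrite fold0 mul0rn.
Qed.

(** The multiplicity of a total transform at a new exceptional divisor is the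
    one that makes it orthogonal to this divisor, and then its intersection
    numbers with the other components do not change. *)
Lemma seq_form_total_transform (W' : acc) (s : sigma_seq W W')
    (v : components W -> R) :
  \sum_i d i * v i = 0 -> forall x, form_app (seq_form s d) (seq_family s v) x = 0.
Proof.
move=> deg0; elim: s => [|W1 W2 s IH sp] /=.
  move=> x; rewrite /form_app; under eq_bigr do rewrite -mulrA.
  by rewrite -mulr_sumr deg0 mulr0.
have e0 : exc_inter sp (extend_family sp (seq_family s v)) = 0.
  rewrite /exc_inter extend_family_new.
  by under eq_bigr do rewrite extend_family_old; rewrite subrr.
apply: (@sp_compP _ _ sp) => [|x]; first by rewrite blow_form_app_new.
rewrite blow_form_app_old e0 mulr0 subr0 -[RHS](IH x); apply: eq_form_app => y.
exact: extend_family_old.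
Qed.

(** The exceptional divisors carry an effective divisor whose opposite is
    relatively ample: blowing up, scale the previous one so that subtracting
    the new divisor does not destroy ampleness. *)
Lemma seq_form_antiample (W' : acc) (s : sigma_seq W W') :
  exists u : components W' -> R,
    [/\ forall i, u (seq_comp s i) = 0,
        forall x, exceptional s x -> 0 < u x &
        forall x, exceptional s x -> form_app (seq_form s d) u x <= - 1].
Proof.
elim: s => [|W1 W2 s [u [u0 upos uQ]] sp] /=.
  by exists (fun=> 0); split=> // x; rewrite exceptional_nil.
set N : R := 1 + (\sum_x comp_nu sp x)%:R.
have N1 : 1 <= N by rewrite lerDl.
have nuN x : (comp_nu sp x)%:R <= N - 1 :> R.
  by rewrite /N addrC addKr ler_nat (bigD1 x) //= leq_addr.
have uge0 x : 0 <= u x.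
  have [/upos/ltW //|/exceptionalPn[i ->]] := boolP (exceptional s x).
  by rewrite u0.
pose u' x' := if [pick x | sp_comp sp (Some x) == x'] is Some x then N * u x
              else (\sum_x N * u x *+ comp_nu sp x) + 1.
have u'o x : u' (sp_comp sp (Some x)) = N * u x by rewrite /u' blow_formE.
have u'E : exc_inter sp u' = - 1.
  rewrite /exc_inter {2}/u' blow_formE opprD addrA.
  by under eq_bigr do rewrite u'o; rewrite subrr add0r.
exists u'; split=> [i||]; first by rewrite u'o u0 mulr0.
- apply: (@sp_compP _ _ sp) => [_|x].
    rewrite /u' blow_formE ltr_wpDl // sumr_ge0 // => x _.
    by rewrite mulrn_wge0 // mulr_ge0 //; lra.
  by rewrite exceptional_old u'o => /upos ux; rewrite mulr_gt0 //; lra.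
apply: (@sp_compP _ _ sp) => [_|x]; first by rewrite blow_form_app_new u'E.
rewrite exceptional_old => /uQ; rewrite blow_form_app_old u'E mulrN1 opprK.
rewrite (eq_form_app _ _ u'o) form_appZ => uQx.
have := nuN x; nra.
Qed.

End IntersectionForm.

(** * The exceptional divisors form a forest *)

Lemma mu_le_inter_num (W : acc) (b1 b2 : branches W) :
  (mu b1 b2 <= inter_num (br_comp b1) (br_comp b2))%N.
Proof.
by rewrite /inter_num (bigD1 b1) //= (bigD1 b2) //= -addnA leq_addr.
Qed.

Lemma sp_br_pt_eq (W W' : acc) (sp : sigma_process W W') b1 b2 :
    br_pt (sp_br sp (inl b1)) = br_pt (sp_br sp (inl b2)) ->
  br_pt b1 = br_pt b2.
Proof.
have pt_inj := bij_inj (sp_pt_bij sp).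
have off b (bP : b \notin branches_at (sp_center sp)) :
    exists2 Q, br_pt b = sval Q & br_pt (sp_br sp (inl b)) = sp_pt sp (inl Q).
  rewrite inE in bP; exists (exist _ (br_pt b) bP) => //.
  exact: sp_br_pt_off.
have [b1P|/off[Q1 e1 ->]] := boolP (b1 \in branches_at (sp_center sp));
  have [b2P|/off[Q2 e2 ->]] := boolP (b2 \in branches_at (sp_center sp)).
- by move: b1P b2P; rewrite !inE => /eqP-> /eqP->.
- by have [B /sp_br_pt_center->] := sp_block_exists b1P => /pt_inj.
- by have [B /sp_br_pt_center->] := sp_block_exists b2P => /pt_inj.
by move=> /pt_inj[e]; rewrite e1 e2 e.
Qed.

Lemma sp_br_pt_newP (W W' : acc) (sp : sigma_process W W') b B :
    br_pt (sp_br sp (inl b)) = br_pt (sp_br sp (inr B)) ->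
  b \in branches_at (sp_center sp).
Proof.
have pt_inj := bij_inj (sp_pt_bij sp).
rewrite sp_br_pt_new; have [//|bP] := boolP (b \in branches_at _).
rewrite inE in bP.
by rewrite (@sp_br_pt_off _ _ sp b (exist _ (br_pt b) bP)) // => /pt_inj.
Qed.

(** The exceptional locus has simple normal crossings. As [sp_nu] is 1 along
    exceptional branches, two exceptional components that cross at the centre
    are separated, so that at most one of them passes through each new point. *)
Lemma exceptional_snc (W W' : acc) (s : sigma_seq W W') : nu_new_le1 s ->
  [/\ forall b1 b2, exceptional s (br_comp b1) ->
        br_pt b1 = br_pt b2 -> br_comp b1 = br_comp b2 -> b1 = b2,
      forall b1 b2 b3, exceptional s (br_comp b1) ->
        exceptional s (br_comp b2) -> exceptional s (br_comp b3) ->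
        br_pt b1 = br_pt b2 -> br_pt b1 = br_pt b3 ->
        [\/ b1 = b2, b1 = b3 | b2 = b3] &
      forall x y, exceptional s x -> exceptional s y ->
        (inter_num x y <= 1)%N].
Proof.
elim: s => [|W1 W2 s IH sp] /=.
  by split=> [b1 b2|b1 b2 b3|x y]; rewrite exceptional_nil.
move=> [/IH[S1 S2 S3] nu1]; have pt_inj := bij_inj (sp_pt_bij sp).
have nu_le1 b : b \in branches_at (sp_center sp) ->
    exceptional s (br_comp b) -> (sp_nu sp b <= 1)%N.
  move=> bP bE; apply: nu1 => //; apply: contraL bE => /codomP[b0 ->].
  by rewrite br_comp_seq_br exceptional_seq_comp.
have sep b1 b2 B : exceptional s (br_comp b1) -> exceptional s (br_comp b2) ->
    br_pt (sp_br sp (inl b1)) = br_pt (sp_br sp (inr B)) ->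
    br_pt (sp_br sp (inl b2)) = br_pt (sp_br sp (inr B)) -> b1 = b2.
  move=> b1E b2E p1 p2; have [c1 c2] := (sp_br_pt_newP p1, sp_br_pt_newP p2).
  have pt : br_pt b1 = br_pt b2 by move: c1 c2; rewrite !inE => /eqP-> /eqP->.
  have [/S1->//|neq] := eqVneq (br_comp b1) (br_comp b2).
  have := sp_mu_center c1 c2 neq.
  have : (0 < mu (sp_br sp (inl b1)) (sp_br sp (inl b2)))%N.
    by rewrite mu_gt0 p1 p2 eqxx !sp_br_comp_old sp_comp_eq.
  have := leq_trans (mu_le_inter_num b1 b2) (S3 _ _ b1E b2E).
  have := sp_nu_gt0 c1; have := sp_nu_gt0 c2; nia.
have comp_nu_le1 x : exceptional s x -> (comp_nu sp x <= 1)%N.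
  move=> xE; have [->//|] := posnP (comp_nu sp x).
  case/comp_nu_gt0P => b bP bx; rewrite /comp_nu (bigD1 b) ?bP ?bx ?eqxx //=.
  rewrite big1 ?addn0 => [|b' /andP[/andP[b'P /eqP b'x] /eqP[]]].
    by rewrite nu_le1 // bx.
  apply: S1; rewrite ?b'x // ?bx //.
  by move: bP b'P; rewrite !inE => /eqP-> /eqP->.
split.
- apply: (@sp_brP _ _ sp) => [b1|B1]; apply: (@sp_brP _ _ sp) => [b2|B2].
  + rewrite !sp_br_comp_old exceptional_old => b1E /sp_br_pt_eq pt.
    by move=> /sp_comp_inj[/(S1 _ _ b1E pt)->].
  + by rewrite sp_br_comp_old sp_br_comp_new => _ _ /sp_comp_inj.
  + by rewrite sp_br_comp_old sp_br_comp_new => _ _ /sp_comp_inj.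
  + by rewrite !sp_br_pt_new => _ /pt_inj[->].
- apply: (@sp_brP _ _ sp) => [b1|B1]; apply: (@sp_brP _ _ sp) => [b2|B2];
    apply: (@sp_brP _ _ sp) => [b3|B3];
    rewrite ?sp_br_comp_old ?exceptional_old => E1 E2 E3 p12 p13.
  + have [] := S2 b1 b2 b3 E1 E2 E3 (sp_br_pt_eq p12) (sp_br_pt_eq p13).
    * by move=> ->; constructor 1.
    * by move=> ->; constructor 2.
    * by move=> ->; constructor 3.
  + by constructor 1; rewrite (sep b1 b2 B3) // -p12.
  + by constructor 2; rewrite (sep b1 b3 B2) // -p13.
  + by constructor 3; move: p13; rewrite p12 !sp_br_pt_new => /pt_inj[->].
  + by constructor 3; rewrite (sep b2 b3 B1).
  + by constructor 2; move: p13; rewrite !sp_br_pt_new => /pt_inj[->].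
  + by constructor 1; move: p12; rewrite !sp_br_pt_new => /pt_inj[->].
  + by constructor 1; move: p12; rewrite !sp_br_pt_new => /pt_inj[->].
apply: (@sp_compP _ _ sp) => [|x]; apply: (@sp_compP _ _ sp) => [|y].
- by rewrite inter_num_self.
- by rewrite exceptional_old inter_num_sym inter_num_new => _ /comp_nu_le1.
- by rewrite exceptional_old inter_num_new => /comp_nu_le1.
rewrite !exceptional_old => xE yE.
exact: leq_trans (inter_num_old_le _ _ _) (S3 _ _ xE yE).
Qed.

(** A graph is a forest on [A] when every nonempty induced subgraph has a vertex
    of degree at most 1; this form lends itself to leaf elimination. *)
Definition forest_on (T : finType) (e : rel T) (A : {set T}) : Prop :=
  forall X : {set T}, X \subset A -> X != set0 ->
  exists2 x, x \in X &
    forall y z, y \in X -> z \in X -> e x y -> e x z -> y = z.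

(** Blowing up a crossing of two exceptional components subdivides the edge
    between them; blowing up another point adds a leaf or an isolated vertex. *)
Lemma exceptional_forest (W W' : acc) (s : sigma_seq W W') : nu_new_le1 s ->
  forest_on (@intersect W') [set x | exceptional s x].
Proof.
have adjE (V : acc) (x y : components V) :
    intersect x y = (0 < inter_num x y)%N.
  apply/existsP/inter_num_gt0P => [[b1 /existsP[b2 /and3P[/eqP<- /eqP<- m]]]|].
    by exists b1, b2.
  by case=> b1 [b2 [<- <- m]]; exists b1; apply/existsP; exists b2; rewrite !eqxx.
elim: s => [|W1 W2 s IH sp] /=.
  move=> _ X /subsetP XE /set0Pn[x /XE].
  by rewrite inE exceptional_nil.
move=> [nu1 _]; have {}IH := IH nu1; have [S1 S2 S3] := exceptional_snc nu1.
move=> X /subsetP XE X0.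
pose E := sp_comp sp None; pose old x := sp_comp sp (Some x).
pose Y := [set x | old x \in X].
have YE : Y \subset [set x | exceptional s x].
  apply/subsetP => x; rewrite [x \in Y]inE => /XE.
  by rewrite !inE exceptional_old.
have adj_old x y : intersect (old x) (old y) -> intersect x y.
  by rewrite !adjE => /leq_trans; apply; apply: inter_num_old_le.
have [/existsP[x1 /existsP[x2 /and5P[x1Y x2Y x12 nu_x1 nu_x2]]]|few] :=
  boolP [exists x1, exists x2, [&& x1 \in Y, x2 \in Y, x1 != x2,
           (0 < comp_nu sp x1)%N & (0 < comp_nu sp x2)%N]]; last first.
  (* At most one vertex of Y is joined to E. *)
  have [EX|EX] := boolP (E \in X).
    exists E => //; apply: (@sp_compP _ _ sp) => [|y];
      apply: (@sp_compP _ _ sp) => [|z] yX zX;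
      rewrite !adjE ?inter_num_self // !(inter_num_sym E) !inter_num_new => Ey Ez.
    have [->//|yz] := eqVneq y z; case/negP: few.
    by apply/existsP; exists y; apply/existsP; exists z; rewrite !inE yX zX yz Ey.
  have Y0 : Y != set0.
    have [x' xX] := set0Pn _ X0; apply/set0Pn; move: xX.
    elim/(@sp_compP _ _ sp): x' => [EX'|x xX]; first by rewrite EX' in EX.
    by exists x; rewrite inE.
  have [x xY xP] := IH _ YE Y0; exists (old x); first by move: xY; rewrite inE.
  apply: (@sp_compP _ _ sp) => [|y]; apply: (@sp_compP _ _ sp) => [|z] yX zX;
    [by []|by rewrite yX in EX|by rewrite zX in EX|].
  by move=> /adj_old xy /adj_old xz; rewrite (xP y z) ?inE.
(* The two vertices joined to E are adjacent before the blow-up only. *)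
have Y0 : Y != set0 by apply/set0Pn; exists x1.
have excY x : x \in Y -> exceptional s x by move/(subsetP YE); rewrite inE.
have meet x y : x != y -> (0 < comp_nu sp x)%N -> (0 < comp_nu sp y)%N ->
    intersect x y.
  rewrite adjE => xy /comp_nu_gt0P[b bP bx] /comp_nu_gt0P[c cP cy].
  apply/inter_num_gt0P; exists b, c; split=> //; rewrite mu_gt0 bx cy xy andbT.
  by move: bP cP; rewrite !inE => /eqP-> /eqP->.
have apart x y : x \in Y -> y \in Y -> x != y -> (0 < comp_nu sp x)%N ->
    (0 < comp_nu sp y)%N -> ~~ intersect (old x) (old y).
  move=> xY yY xy; have := S3 _ _ (excY _ xY) (excY _ yY).
  rewrite -(inter_num_old sp xy) adjE -leqNgt => le1 nu_x nu_y.
  have nu_xy : (0 < comp_nu sp x * comp_nu sp y)%N by rewrite muln_gt0 nu_x.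
  by rewrite -(leq_add2r 1); apply: leq_trans le1; rewrite leq_add2l.
have only x : x \in Y -> (0 < comp_nu sp x)%N -> (x == x1) || (x == x2).
  move=> xY nu_x; case/comp_nu_gt0P: (nu_x) => b bP bx.
  case/comp_nu_gt0P: (nu_x1) => b1 b1P b1x; case/comp_nu_gt0P: (nu_x2) => b2 b2P b2x.
  have := S2 b b1 b2; rewrite bx b1x b2x => /(_ (excY _ xY) (excY _ x1Y) (excY _ x2Y)).
  move: bP b1P b2P; rewrite !inE => /eqP-> /eqP-> /eqP-> /(_ erefl erefl)[e|e|e].
  - by rewrite -bx e b1x eqxx.
  - by rewrite -bx e b2x eqxx orbT.
  - by move: x12; rewrite -b1x e b2x eqxx.
have [x xY xP] := IH _ YE Y0; exists (old x); first by move: xY; rewrite inE.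
have partner : (0 < comp_nu sp x)%N -> exists x',
    [/\ x' \in Y, x != x' & (0 < comp_nu sp x')%N].
  move=> /(only _ xY)/orP[] /eqP->; last by exists x1; rewrite eq_sym.
  by exists x2.
(* A vertex joined to E has its only old neighbour on the other side of E. *)
have lone y : intersect (old x) E -> y \in Y -> ~~ intersect (old x) (old y).
  rewrite adjE inter_num_new => nu_x yY; have [x' [x'Y xx' nu_x']] := partner nu_x.
  apply/negP => xy.
  have e := xP _ _ yY x'Y (adj_old _ _ xy) (meet _ _ xx' nu_x nu_x').
  by case/negP: (apart _ _ xY x'Y xx' nu_x nu_x'); rewrite -e.
apply: (@sp_compP _ _ sp) => [|y]; apply: (@sp_compP _ _ sp) => [|z] // yX zX.
- by move=> xE; rewrite (negPf (lone z xE _)) // inE.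
- by move=> xy xE; move: xy; rewrite (negPf (lone y xE _)) // inE.
by move=> /adj_old xy /adj_old xz; rewrite (xP y z) ?inE.
Qed.

(** * Harmonic families on a forest *)

Section Harmonic.
Variables (R : realFieldType) (T J : finType) (j0 : J).
Hypothesis J3 : forall j j' : J, exists2 k, k != j & k != j'.

(** Up to adding a constant, the vector [(M i x)_i] is a multiple of the [j]-th
    basis vector. *)
Definition along (M : J -> T -> R) (j : J) (x : T) : Prop :=
  forall i i', i != j -> i' != j -> M i x = M i' x.

Definition peak (M : J -> T -> R) (j : J) (x : T) : Prop :=
  along M j x /\ forall i, M i x <= M j x.

Lemma along_two M j k x :
  along M j x -> along M k x -> j != k -> forall i i', M i x = M i' x.
Proof.
move=> Mj Mk jk; have [l lj lk] := J3 j k.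
suff Ml i : M i x = M l x by move=> i i'; rewrite !Ml.
have [->|ij] := eqVneq i j; first exact: Mk.
exact: Mj.
Qed.

Lemma peak_const M x : (forall i i', M i x = M i' x) -> forall j, peak M j x.
Proof. by move=> e j; split=> [i i' _ _|i]; rewrite (e i j). Qed.

Lemma peak_along M j k x : peak M j x -> along M k x -> peak M k x.
Proof.
move=> pj Mk; have [<-//|jk] := eqVneq j k.
by apply: peak_const; apply: along_two jk; [case: pj|].
Qed.

Variable w : T -> T -> R.
Hypothesis w_sym : forall x y, w x y = w y x.
Hypothesis w_ge0 : forall x y, 0 <= w x y.
Hypothesis w_diag : forall x, w x x = 0.
Variable M : J -> T -> R.

(** Solutions of a Dirichlet problem on a forest whose sources [b] take values
    in the cone of the basis vectors, with the extra condition that [M] is along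
    the direction of each source present at a vertex. The function [u] makes
    the matrix with diagonal [a] and off-diagonal entries [- w] positive
    definite. A leaf can be eliminated: either two sources make [M] constant
    there, and the leaf is invisible from its neighbour, or it passes its only
    source, if any, on to its neighbour. *)
Lemma forest_harmonic_peak (A : {set T}) (a u : T -> R) (b : J -> T -> R) :
    forest_on (fun x y => 0 < w x y) A ->
    {in A, forall x, 0 < u x} ->
    {in A, forall x, \sum_(y in A) w x y * u y < a x * u x} ->
    {in A, forall x j, 0 <= b j x} ->
    {in A, forall x j, 0 < b j x -> along M j x} ->
    {in A, forall x i j, a x * (M i x - M j x) =
      b i x - b j x + \sum_(y in A) w x y * (M i y - M j y)} ->
  {in A, forall x, exists j, peak M j x} /\
  {in A &, forall x y, 0 < w x y -> exists2 j, peak M j x & peak M j y}.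
Proof.
have [n] := ubnP #|A|; elim: n A a b => // n IH A a b; rewrite ltnS => leAn.
move=> forestA u_gt0 cert b_ge0 b_along harm.
have [A0|A0] := eqVneq A set0; first by rewrite A0; split=> x; rewrite inE.
have [x xA x_leaf] := forestA A (subxx A) A0.
pose A' := A :\ x; have A'A y : y \in A' -> y \in A by case/setD1P.
have ltA'n : (#|A'| < n)%N by rewrite (cardsD1 x) xA in leAn.
have forestA' : forest_on (fun x y => 0 < w x y) A'.
  by move=> X XA'; apply: forestA; apply: subset_trans XA' (subsetDl _ _).
have sumA (F : T -> R) : \sum_(y in A) F y = F x + \sum_(y in A') F y.
  by rewrite (big_setD1 x).
have sum_ge0 y (B : {set T}) : {subset B <= A} -> 0 <= \sum_(z in B) w y z * u z.
  by move=> BA; rewrite sumr_ge0 // => z /BA zA; rewrite mulr_ge0 // ltW ?u_gt0.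
have a_gt0 : 0 < a x.
  by rewrite -(pmulr_lgt0 _ (u_gt0 x xA)); apply: le_lt_trans (cert x xA); apply: sum_ge0.
have [detached|] := boolP [|| [forall p in A, w x p == 0] |
    [forall i, forall i', M i x == M i' x]].
  have [|||||pk pk2] := IH A' a b ltA'n forestA'.
  - by move=> y /A'A; apply: u_gt0.
  - move=> y /A'A yA; apply: le_lt_trans (cert y yA); rewrite sumA lerDr.
    by rewrite mulr_ge0 // ltW // u_gt0.
  - by move=> y /A'A; apply: b_ge0.
  - by move=> y /A'A; apply: b_along.
  - move=> y /A'A yA i j; rewrite (harm y yA i j) sumA; congr (_ + _).
    suff -> : w y x * (M i x - M j x) = 0 by rewrite add0r.
    case/orP: detached => [/forall_inP/(_ y yA)/eqP|].
      by rewrite w_sym => ->; rewrite mul0r.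
    by move=> /forallP/(_ i)/forallP/(_ j)/eqP->; rewrite subrr mulr0.
  have x_peak : exists j, peak M j x.
    case: (pickP (fun j => 0 < b j x)) => [j bj|b0]; last first.
      case/orP: detached => [/forall_inP w0|/forallP triv]; exists j0;
        apply: peak_const => i i'; last by apply/eqP; move: i'; apply/forallP.
      apply/eqP; rewrite -subr_eq0 -(mulrI_eq0 _ (lregP (lt0r_neq0 a_gt0))).
      rewrite harm // big1 => [|y /w0/eqP->]; last by rewrite mul0r.
      have b_eq0 k : b k x = 0 by apply/eqP; rewrite eq_le b_ge0 // leNgt b0.
      by rewrite !b_eq0 subrr addr0.
    have xj := b_along x xA j bj; exists j; split=> // i.
    have [->//|ij] := eqVneq i j.
    have [bi|] := boolP (0 < b i x).
      by rewrite (along_two (b_along x xA i bi) xj ij i j).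
    rewrite -leNgt => bi_le0.
    case/orP: detached => [/forall_inP w0|/forallP/(_ i)/forallP/(_ j)/eqP-> //].
    have := harm x xA i j; rewrite big1 => [|y /w0/eqP->]; last by rewrite mul0r.
    have bi_ge0 := b_ge0 x xA i; rewrite -subr_le0 => e.
    by rewrite -(pmulr_rle0 _ a_gt0) e; lra.
  have x_edge y : y \in A -> 0 < w x y -> exists2 j, peak M j x & peak M j y.
    move=> yA wxy; have yx : y != x by apply: contraTneq wxy => ->; rewrite w_diag ltxx.
    have [j yj] : exists j, peak M j y by apply: pk; rewrite !inE yx.
    exists j => //; apply: peak_const => i i'.
    case/orP: detached => [/forall_inP/(_ y yA)/eqP w0|/forallP/(_ i)/forallP/(_ i')/eqP //].
    by rewrite w0 ltxx in wxy.
  split=> [y yA|y z yA zA wyz].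
    by have [->//|yx] := eqVneq y x; apply: pk; rewrite !inE yx.
  have [yx|yx] := eqVneq y x; first by rewrite yx in wyz *; apply: x_edge.
  have [zx|zx] := eqVneq z x.
    by rewrite zx w_sym in wyz *; have [j] := x_edge y yA wyz; exists j.
  by apply: pk2; rewrite ?inE ?yx ?zx.
rewrite negb_or => /andP[/forallPn[p]]; rewrite negb_imply => /andP[pA wxp].
move=> /forallPn[i0 /forallPn[i1 nontriv]].
have {}wxp : 0 < w x p by rewrite lt0r wxp w_ge0.
have px : p != x by apply: contraTneq wxp => ->; rewrite w_diag ltxx.
have pA' : p \in A' by rewrite !inE px.
have w_only y : y \in A -> y != p -> w x y = 0.
  move=> yA yp; apply/eqP; rewrite eq_le w_ge0 andbT leNgt.
  by apply: contra_neqN yp => wxy; apply: x_leaf.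
have source_uniq j k : 0 < b j x -> k != j -> b k x = 0.
  move=> bj kj; apply/eqP; rewrite eq_le b_ge0 // andbT leNgt.
  apply: contraNN nontriv => bk; apply/eqP.
  exact: along_two (b_along x xA k bk) (b_along x xA j bj) kj _ _.
have x_eq i j : a x * (M i x - M j x) = b i x - b j x + w x p * (M i p - M j p).
  rewrite harm // (bigD1 p) //= big1 ?addr0 // => y /andP[yA yp].
  by rewrite w_only // mul0r.
have p_along j : 0 < b j x -> along M j p.
  move=> bj i i' ij i'j; have xj := b_along x xA j bj.
  have := x_eq i i'; rewrite (xj i i') // (source_uniq j i bj ij).
  rewrite (source_uniq j i' bj i'j) !subrr mulr0 add0r.
  move=> /esym/eqP; rewrite mulf_eq0 gt_eqF //= => /eqP e.
  by apply/eqP; rewrite -subr_eq0 e.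
have x_peak j : peak M j p -> exists2 k, peak M k x & peak M k p.
  case: (pickP (fun k => 0 < b k x)) => [k bk|b0] pj; last first.
    have b_eq0 k : b k x = 0 by apply/eqP; rewrite eq_le b_ge0 // leNgt b0.
    have x_eq' i i' : M i x - M i' x = w x p / a x * (M i p - M i' p).
      by apply: (mulfI (lt0r_neq0 a_gt0)); rewrite x_eq !b_eq0; field; lra.
    exists j => //; case: pj => pj pj'; split=> [i i' ij i'j|i].
      by apply/eqP; rewrite -subr_eq0 x_eq' (pj i i') // subrr mulr0.
    rewrite -subr_le0 x_eq' pmulr_rle0 ?divr_gt0 // subr_le0.
    exact: pj'.
  have pk := peak_along pj (p_along k bk); exists k => //.
  split=> [|i]; first exact: b_along.
  rewrite -subr_le0 -(pmulr_rle0 _ a_gt0) x_eq.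
  have [->|ik] := eqVneq i k; first by rewrite !subrr mulr0 addr0.
  by rewrite (source_uniq k i bk ik); case: pk => _ /(_ i); nra.
(* Solving the equation at x for M x and substituting it in the one at p leaves
   a problem of the same kind on A', with new data at p only. *)
pose a' y := if y == p then a p - w x p ^+ 2 / a x else a y.
pose b' j y := if y == p then b j p + w x p / a x * b j x else b j y.
have wax : 0 < w x p / a x by rewrite divr_gt0.
have [|||||pk pk2] := IH A' a' b' ltA'n forestA'.
- by move=> y /A'A; apply: u_gt0.
- move=> y /A'A yA; have := cert y yA; rewrite sumA /a'.
  have [->|yp] := eqVneq y p; last by rewrite w_sym w_only // mul0r add0r.
  have := cert x xA; rewrite sumA w_diag mul0r add0r (big_setD1 p) //=.
  rewrite big1 => [|y' /setD1P[y'p /A'A y'A]]; last by rewrite w_only ?mul0r.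
  rewrite addr0 [w p x]w_sym -(ltr_pM2l wax) => c1 c2.
  rewrite mulrBl; move: c1.
  have -> : w x p / a x * (a x * u x) = w x p * u x by field; lra.
  have -> : w x p / a x * (w x p * u p) = w x p ^+ 2 / a x * u p by ring.
  lra.
- move=> y /A'A yA j; rewrite /b'; case: eqP => _; last exact: b_ge0.
  by rewrite addr_ge0 ?b_ge0 // mulr_ge0 ?b_ge0 // ltW.
- move=> y /A'A yA j; rewrite /b'; have [->|yp] := eqVneq y p; last exact: b_along.
  have [/p_along //|] := boolP (0 < b j x); rewrite -leNgt => bx.
  have bx0 : b j x = 0 by apply/eqP; rewrite eq_le bx b_ge0.
  by rewrite bx0 mulr0 addr0; apply: b_along.
- move=> y /A'A yA i j; have := harm y yA i j; rewrite sumA /a' /b'.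
  have [->|yp] := eqVneq y p; last by rewrite w_sym w_only // mul0r add0r.
  rewrite [w p x]w_sym => e; rewrite mulrBl e.
  have -> : M i x - M j x = (b i x - b j x + w x p * (M i p - M j p)) / a x.
    by rewrite -x_eq mulrC mulKf // gt_eqF.
  by ring.
have p_edge : exists2 k, peak M k x & peak M k p.
  by have [j /x_peak] := pk p pA'.
split=> [y yA|y z yA zA wyz].
  have [->|yx] := eqVneq y x; first by case: p_edge => k; exists k.
  by apply: pk; rewrite !inE yx.
have [yx|yx] := eqVneq y x.
  rewrite yx in wyz *; have [->//|zp] := eqVneq z p.
  by rewrite w_only ?ltxx in wyz.
have [zx|zx] := eqVneq z x; last by apply: pk2; rewrite ?inE ?yx ?zx.
rewrite zx w_sym in wyz *; have [->|yp] := eqVneq y p.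
  by case: p_edge => k; exists k.
by rewrite w_only ?ltxx in wyz.
Qed.

End Harmonic.

(** * Degrees *)

Section Degree.
Variables (R : rcfType) (W : acc).
Hypothesis bezW : bezout W.
Implicit Types i j k : components W.

Lemma degree_quot i j k :
  uniq [:: i; j; k] -> degree R i = Num.sqrt (ratr (bezout_quot i j k)).
Proof.
move=> ijk; rewrite /degree; case: pickP => [[j' k'] ijk'|/(_ (j, k))]; last first.
  by rewrite [uniq _]ijk.
by have [_ /(_ _ _ _ _ _ ijk ijk')->] := bezW.
Qed.

Lemma inter_num_pos i j k : uniq [:: i; j; k] -> (0 < inter_num j k)%N.
Proof. by move=> ijk; rewrite lt0n; apply/eqP; have [/(_ _ _ _ ijk)] := bezW. Qed.

Lemma degree_pos i j k : uniq [:: i; j; k] -> 0 < degree R i.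
Proof.
move=> ijk; rewrite (degree_quot ijk) sqrtr_gt0 ltr0q /bezout_quot.
have jk := inter_num_pos ijk.
have ik : (0 < inter_num i k)%N.
  by apply: (@inter_num_pos j); move: ijk; rewrite /= !inE (eq_sym j i); lia.
have ij : (0 < inter_num i j)%N.
  by apply: (@inter_num_pos k); move: ijk; rewrite /= !inE !(eq_sym k); lia.
by rewrite divr_gt0 ?mulr_gt0 ?ltr0n.
Qed.

Lemma degree_mul i j k :
  uniq [:: i; j; k] -> degree R i * degree R j = (inter_num i j)%:R.
Proof.
move=> ijk; have jik : uniq [:: j; i; k].
  by move: ijk; rewrite /= !inE (eq_sym j i); lia.
have jk := inter_num_pos ijk; have ik := inter_num_pos jik.
rewrite (degree_quot ijk) (degree_quot jik) -sqrtrM; last first.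
  by rewrite ler0q /bezout_quot divr_ge0 ?mulr_ge0 ?ler0n.
rewrite -rmorphM /=.
have -> : bezout_quot i j k * bezout_quot j i k = (inter_num i j)%:R ^+ 2.
  rewrite /bezout_quot (inter_num_sym j i); field.
  by rewrite !pnatr_eq0; lia.
by rewrite rmorphXn /= ratr_nat sqrtr_sqr ger0_norm ?ler0n.
Qed.

End Degree.

(** The degrees are commensurable: they become integers once multiplied by the
    degree of a fixed component [i] and the intersection number of two others. *)
Lemma degree_scale (R : numFieldType) (W : acc) (d : components W -> R)
    (i j k : components W) :
    uniq [:: i; j; k] -> (forall l, 0 < d l) ->
    (forall l l', l != l' -> d l * d l' = (inter_num l l')%:R) ->
  exists2 K : R, 0 < K & exists a : components W -> nat,
    forall l, d l * K = (a l)%:R.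
Proof.
rewrite /= !inE negb_or => /and3P[/andP[ij ik] jk _] d_gt0 dM.
exists (d i * (d j * d k)); first by rewrite !mulr_gt0.
exists (fun l => if l == i then inter_num i j * inter_num i k
                 else inter_num l i * inter_num j k)%N => l.
case: eqVneq => [->|li]; rewrite natrM -!dM //; ring.
Qed.

(** * Multiplicities along the exceptional divisors *)

Section Peaks.
Variables (R : realFieldType) (W What : acc) (s : sigma_seq W What).
Hypothesis res : is_resolution s.
Variable d : components W -> R.
Hypothesis dM : forall i j, i != j -> d i * d j = (inter_num i j)%:R.
Variables (J : finType) (j0 : J).
Hypothesis J3 : forall j j' : J, exists2 k, k != j & k != j'.

(** The divisor of multiplicities [m] supported by the components of colour [j];
    a pencil is given by the colouring whose classes are its fibers. *)
Definition colour_family (I : Type) (C : eqType) (m : I -> nat) (col : I -> C)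
    (j : C) (i : I) : R := (m i)%:R * (col i == j)%:R.

Variables (m : components W -> nat) (col : components W -> J).
Hypothesis m_gt0 : forall i, (0 < m i)%N.
Hypothesis degP : forall j j',
  \sum_i d i * colour_family m col j i = \sum_i d i * colour_family m col j' i.
Hypothesis localP : forall b j j',
  j != col (br_comp b) -> j' != col (br_comp b) ->
  branch_inter (colour_family m col j) b = branch_inter (colour_family m col j') b.

Local Notation M j := (seq_family s (colour_family m col j)).
Local Notation Q := (seq_form s d).

Lemma colour_family_neq j i : j != col i -> colour_family m col j i = 0.
Proof. by rewrite /colour_family eq_sym => /negPf->; rewrite mulr0. Qed.

Lemma colour_family_eq i : colour_family m col (col i) i = (m i)%:R.
Proof. by rewrite /colour_family eqxx mulr1. Qed.

(** The intersection condition of the pencil passes to the total transforms,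
    and in a resolution it involves a single neighbour at a time. *)
Lemma along_neighbour i y :
  (0 < inter_num (seq_comp s i) y)%N -> along (fun j => M j) (col i) y.
Proof.
case: res => _ two le1 /inter_num_gt0P[b1 [b2 [/br_comp_seq_compP[b -> bi] <- mu0]]].
rewrite -bi => j j' jb j'b.
rewrite -!(branch_inter_normal_crossing _ two le1 mu0).
rewrite !branch_inter_seq_family ?colour_family_neq //.
exact: localP.
Qed.

Lemma difference_orthogonal i k x : form_app Q (fun y => M i y - M k y) x = 0.
Proof.
rewrite -[RHS](@seq_form_total_transform R W d What s
  (fun l => colour_family m col i l - colour_family m col k l) _ x).
  by apply: eq_form_app => y; rewrite seq_familyB.
under eq_bigr do rewrite mulrBr.
by rewrite sumrB (degP i k) subrr.
Qed.

Lemma exceptional_peak :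
  (forall x, exists j, peak (fun j => M j) j x) /\
  (forall x y, exceptional s x -> exceptional s y -> (0 < inter_num x y)%N ->
     exists2 j, peak (fun j => M j) j x & peak (fun j => M j) j y).
Proof.
pose w (x y : components What) : R := (inter_num x y)%:R.
pose A := [set x | exceptional s x].
have w_diag x : w x x = 0 by rewrite /w inter_num_self.
have [u [u0 u_gt0 uQ]] := seq_form_antiample d s.
pose b j x : R := \sum_(y | y \notin A) w x y * M j y.
have formE (f : components What -> R) x :
    form_app Q f x = Q x x * f x + \sum_y w x y * f y.
  rewrite /form_app (bigD1 x) //= [X in _ = _ + X](bigD1 x) //=.
  rewrite [w x x]w_diag mul0r add0r; congr (_ + _).
  by apply: eq_bigr => y yx; rewrite seq_form_inter // eq_sym.
have M_orig j i : M j (seq_comp s i) = colour_family m col j i.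
  exact: seq_family_comp.
have splitA (F : components What -> R) :
    \sum_y F y = \sum_(y in A) F y + \sum_(y | y \notin A) F y.
  by rewrite (bigID (mem A)).
have origP x : x \notin A -> exists i, x = seq_comp s i.
  by rewrite inE => /exceptionalPn.
have fam_ge0 j i : 0 <= colour_family m col j i by rewrite mulr_ge0 ?ler0n.
have [|||||||||pk pk2] := @forest_harmonic_peak R _ J j0 J3 w _ _ _ (fun j => M j)
    A (fun x => - Q x x) u b.
- by move=> x y; rewrite /w inter_num_sym.
- by move=> x y; apply: ler0n.
- exact: w_diag.
- case: res => /exceptional_forest forest _ _ X XA X0.
  have [x xX xP] := forest X XA X0; exists x => // y z yX zX.
  rewrite /w !ltr0n => xy xz; apply: xP => //; rewrite /intersect;
  [move: xy|move: xz] => /inter_num_gt0P[b1 [b2 [<- <- mu0]]];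
  by apply/existsP; exists b1; apply/existsP; exists b2; rewrite !eqxx.
- by move=> x; rewrite inE; apply: u_gt0.
- move=> x; rewrite inE => /uQ; rewrite formE splitA [X in _ + (_ + X)]big1; first lra.
  by move=> y /origP[i ->]; rewrite u0 mulr0.
- move=> x _ j; apply: sumr_ge0 => y /origP[i ->].
  by rewrite M_orig mulr_ge0 // ler0n.
- move=> x _ j bj.
  have [y /origP[i ->]] : exists2 y, y \notin A & 0 < w x y * M j y.
    apply/exists_inP; apply: contraLR bj => /exists_inPn none.
    by rewrite -leNgt; apply: sumr_le0 => y /none; rewrite -leNgt.
  rewrite M_orig => pos; have -> : j = col i.
    apply/eqP; apply: contraTT pos => /colour_family_neq->.
    by rewrite mulr0 ltxx.
  apply: along_neighbour; rewrite lt0n inter_num_sym; apply: contraTneq pos => e.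
  by rewrite /w e mul0r ltxx.
- move=> x _ i j; have := difference_orthogonal i j x.
  rewrite formE splitA => e.
  have -> : b i x - b j x = \sum_(y | y \notin A) w x y * (M i y - M j y).
    by rewrite -sumrB; apply: eq_bigr => y _; rewrite mulrBr.
  lra.
split=> [x|x y xE yE xy]; last first.
  by apply: pk2; rewrite ?inE // /w ltr0n.
have [/pk//|/origP[i ->]] := boolP (x \in A).
exists (col i); split=> [j j' jc j'c|j]; rewrite !M_orig.
  by rewrite !colour_family_neq.
have [->//|jc] := eqVneq j (col i).
by rewrite colour_family_neq // colour_family_eq ler0n.
Qed.

(** Once their common part is removed, the total transforms of the fibers are
    disjoint: the multiplicity [N x] left at [x] belongs to the single fiber
    [top x]. Only differences are recorded, so the common part does not appear.
    The components with [N x = 0] are the trivial ones. *)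
Lemma exists_fiber_divisors :
  exists (top : components What -> J) (N : components What -> R),
  [/\ forall x, 0 <= N x,
      forall i k x,
        M i x - M k x = N x * ((top x == i)%:R - (top x == k)%:R),
      forall x y, (0 < inter_num x y)%N -> 0 < N x -> 0 < N y -> top x = top y,
      forall i, top (seq_comp s i) = col i &
      forall i, N (seq_comp s i) = (m i)%:R].
Proof.
have [pk pk2] := exceptional_peak.
have [top topP] := fin_all_exists pk.
have [alt altP] : exists alt : J -> J, forall j, alt j != j.
  by apply: (@fin_all_exists _ _ (fun j k => k != j)) => j; have [k] := J3 j j; exists k.
pose N x := M (top x) x - M (alt (top x)) x.
have NE i k x : M i x - M k x = N x * ((top x == i)%:R - (top x == k)%:R).
  have [al _] := topP x; have altN := altP (top x).
  have val l : M l x = M (alt (top x)) x + N x * (top x == l)%:R.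
    rewrite eq_sym; case: eqVneq => [->|lt]; first by rewrite mulr1 /N addrC subrK.
    by rewrite mulr0 addr0; apply: al.
  by rewrite (val i) (val k); ring.
have N_ge0 x : 0 <= N x by rewrite subr_ge0; case: (topP x).
have top_uniq x j : 0 < N x -> along (fun j => M j) j x -> top x = j.
  move=> Nx xj; apply/eqP; apply: contraLR Nx => ne.
  rewrite -leNgt subr_le0 le_eqVlt; apply/orP; left; apply/eqP.
  by apply: (along_two J3 _ xj ne); case: (topP x).
have M_orig j i : M j (seq_comp s i) = colour_family m col j i.
  exact: seq_family_comp.
have top_orig i : top (seq_comp s i) = col i.
  apply/eqP; apply: contraT => ne; have [_ /(_ (col i))] := topP (seq_comp s i).
  rewrite !M_orig colour_family_eq colour_family_neq // lern0.
  by rewrite eqn0Ngt m_gt0.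
exists top, N; split=> // [x y xy Nx Ny|i].
  have [xE|/exceptionalPn[i xi]] := boolP (exceptional s x); last first.
    rewrite xi top_orig (top_uniq y (col i)) //.
    by apply: along_neighbour; rewrite -xi.
  have [yE|/exceptionalPn[i yi]] := boolP (exceptional s y); last first.
    rewrite yi top_orig (top_uniq x (col i)) //.
    by apply: along_neighbour; rewrite -yi inter_num_sym.
  have [j [xj _] [yj _]] := pk2 x y xE yE xy.
  by rewrite (top_uniq x j) // (top_uniq y j).
by rewrite /N !M_orig top_orig colour_family_eq colour_family_neq // subr0.
Qed.

End Peaks.

(** * Connected components of the fibers *)

Section FiberComponents.
Variables (R : realFieldType) (W What : acc) (s : sigma_seq W What).
Variable d : components W -> R.
Hypothesis d_gt0 : forall i, 0 < d i.
Hypothesis dM : forall i j, i != j -> d i * d j = (inter_num i j)%:R.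
Variables (J : finType) (top : components What -> J) (N : components What -> R).
Hypothesis J2 : forall j : J, exists k, k != j.
Hypothesis N_ge0 : forall x, 0 <= N x.
Hypothesis top_eq : forall x y,
  (0 < inter_num x y)%N -> 0 < N x -> 0 < N y -> top x = top y.
Hypothesis fibers_equiv : forall i k x,
  form_app (seq_form s d)
    (fun y => N y * ((top y == i)%:R - (top y == k)%:R)) x = 0.
Local Notation Q := (seq_form s d).

Definition nontrivial_adj : rel (components What) :=
  fun x y => [&& (0 < inter_num x y)%N, 0 < N x & 0 < N y].

(** Connected components of the fibers are named by a representative. *)
Definition fiber_component (x : components What) := fingraph.root nontrivial_adj x.

Lemma nontrivial_connect_sym : connect_sym nontrivial_adj.
Proof.
apply: sym_connect_sym => x y; rewrite /nontrivial_adj inter_num_sym.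
by congr (_ && _); apply: andbC.
Qed.

Lemma fiber_component_adj x y :
  nontrivial_adj x y -> fiber_component x = fiber_component y.
Proof.
by move=> xy; apply/eqP; rewrite (root_connect nontrivial_connect_sym) connect1.
Qed.

Lemma fiber_component_top x y :
  fiber_component x = fiber_component y -> top x = top y.
Proof.
move=> /eqP; rewrite (root_connect nontrivial_connect_sym) => /connectP[p].
elim: p x => [|z p IH] x /= => [_ ->//|/andP[/and3P[xz Nx Nz] zp] /(IH _ zp) <-].
exact: top_eq.
Qed.

Definition component_divisor (c x : components What) : R :=
  if fiber_component x == c then N x else 0.

Definition component_degree (c : components What) : R :=
  \sum_i d i * component_divisor c (seq_comp s i).

Lemma component_divisor_ge0 c x : 0 <= component_divisor c x.
Proof. by rewrite /component_divisor; case: ifP. Qed.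

(** Near a vertex of one of its components, a fiber is that component. *)
Lemma component_orthogonal c y : 0 < N y -> form_app Q (component_divisor c) y = 0.
Proof.
move=> Ny; have [k ky] := J2 (top y).
suff e x : Q y x * component_divisor c x = (fiber_component y == c)%:R *
    (Q y x * (N x * ((top x == top y)%:R - (top x == k)%:R))).
  rewrite /form_app; under eq_bigr do rewrite e.
  rewrite -mulr_sumr; have := fibers_equiv (top y) k y.
  by rewrite /form_app => ->; rewrite mulr0.
have [Nx|/negP/negP] := boolP (0 < N x); last first.
  rewrite -leNgt => Nx; have Nx0 : N x = 0 by apply/eqP; rewrite eq_le Nx N_ge0.
  by rewrite /component_divisor Nx0 if_same !(mul0r, mulr0).
have same : fiber_component x = fiber_component y -> top x = top y ->
    Q y x * component_divisor c x = (fiber_component y == c)%:R *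
    (Q y x * (N x * ((top x == top y)%:R - (top x == k)%:R))).
  move=> cxy ->; rewrite /component_divisor cxy eqxx [top y == k]eq_sym (negPf ky).
  by case: eqP => _; rewrite ?mul1r ?mul0r ?mulr0 // subr0 mulr1.
have [e|xy] := eqVneq x y; first by apply: same; rewrite e.
have [e0|e1] := posnP (inter_num y x).
  by rewrite seq_form_inter 1?eq_sym // e0 !(mul0r, mulr0).
apply: same; last by rewrite (top_eq e1).
by apply/esym/fiber_component_adj/and3P.
Qed.

Lemma form_sq_nontrivial f :
    (forall x, f x = 0 \/ 0 < N x) ->
    (forall x, 0 < N x -> form_app Q f x = 0) ->
  form_sq Q f = 0.
Proof.
move=> f_supp fQ; rewrite /form_sq big1 // => x _.
by have [->|/fQ->] := f_supp x; rewrite ?mul0r ?mulr0.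
Qed.

Lemma component_divisor_supp c x : component_divisor c x = 0 \/ 0 < N x.
Proof.
rewrite /component_divisor; case: ifP; [|by left].
by rewrite lt0r N_ge0 andbT; have [->|] := eqVneq (N x) 0; [left|right].
Qed.

(** A component of a fiber without components of [W] would be an isotropic
    combination of exceptional divisors. *)
Lemma component_degree_gt0 x : 0 < N x -> 0 < component_degree (fiber_component x).
Proof.
set c := fiber_component x => Nx.
have term_ge0 i : 0 <= d i * component_divisor c (seq_comp s i).
  by rewrite mulr_ge0 ?component_divisor_ge0 // ltW.
rewrite lt0r sumr_ge0 ?andbT //; apply: contraTneq Nx => deg0.
have D0 i : component_divisor c (seq_comp s i) = 0.
  have /eqP := deg0; rewrite psumr_eq0 // => /allP/(_ i).
  by rewrite mem_index_enum mulf_eq0 gt_eqF //= => /(_ isT)/eqP.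
have [_ /(_ _) DQ] := seq_form_hodge deg0.
have {}DQ := DQ (form_sq_nontrivial (component_divisor_supp c) (component_orthogonal c)).
have := seq_form_exc_nondegenerate D0 (fun x _ => DQ x) x.
by rewrite /component_divisor eqxx => ->; rewrite ltxx.
Qed.

(** Disjoint isotropic divisors are proportional, by the index theorem. *)
Lemma component_proportional c c' x :
  form_app Q (fun y => component_degree c' * component_divisor c y -
                       component_degree c * component_divisor c' y) x = 0.
Proof.
have [] := @seq_form_hodge R W d What s (fun y =>
  component_degree c' * component_divisor c y -
  component_degree c * component_divisor c' y).
  under eq_bigr do rewrite mulrBr !(mulrCA (d _)).
  by rewrite sumrB -!mulr_sumr mulrC subrr.
move=> _; apply; apply: form_sq_nontrivial => [y|y Ny].
  have [->|] := component_divisor_supp c y; last by right.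
  have [->|] := component_divisor_supp c' y; last by right.
  by left; rewrite !mulr0 subrr.
by rewrite form_appB !form_appZ !component_orthogonal // !mulr0 subrr.
Qed.

(** The pencil whose fibers are the components of the fibers, each one with its
    multiplicities rescaled so that all have the same degree [kappa]. *)
Variables (m m2 : components W -> nat) (kappa : R).
Hypothesis m_gt0 : forall i, (0 < m i)%N.
Hypothesis kappa_gt0 : 0 < kappa.
Hypothesis N_orig : forall i, N (seq_comp s i) = (m i)%:R.
Hypothesis m2P : forall i,
  (m2 i)%:R * component_degree (fiber_component (seq_comp s i)) = kappa * (m i)%:R.

Definition refined_colour (i : components W) := fiber_component (seq_comp s i).
Local Notation fam2 c := (colour_family R m2 refined_colour c).

Lemma N_orig_gt0 i : 0 < N (seq_comp s i).
Proof. by rewrite N_orig ltr0n. Qed.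

Lemma refined_degree_gt0 i : 0 < component_degree (refined_colour i).
Proof. exact: component_degree_gt0 (N_orig_gt0 i). Qed.

Lemma refined_familyE i0 i : let c := refined_colour i0 in
  fam2 c i = kappa / component_degree c * component_divisor c (seq_comp s i).
Proof.
rewrite /colour_family /component_divisor /= -/(refined_colour i) N_orig.
case: eqP => [<-|]; last by rewrite !mulr0.
have deg_neq0 := lt0r_neq0 (refined_degree_gt0 i).
by apply: (mulIf deg_neq0); rewrite mulr1 m2P; field.
Qed.

Lemma refined_degree i0 : \sum_i d i * fam2 (refined_colour i0) i = kappa.
Proof.
under eq_bigr do rewrite refined_familyE mulrCA.
by rewrite -mulr_sumr divfK // gt_eqF // refined_degree_gt0.
Qed.

(** The new multiplicities of the exceptional divisors need no computation: the
    difference of two rescaled components and that of the two total transforms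
    are both numerically trivial and agree on the components of [W]. *)
Lemma refined_multiplicity i1 i2 x :
  let c1 := refined_colour i1 in let c2 := refined_colour i2 in
  seq_family s (fam2 c1) x - seq_family s (fam2 c2) x =
  kappa / component_degree c1 * component_divisor c1 x -
  kappa / component_degree c2 * component_divisor c2 x.
Proof.
move=> c1 c2; apply/eqP; rewrite -subr_eq0; apply/eqP.
have [deg1 deg2] := (refined_degree_gt0 i1, refined_degree_gt0 i2).
move: x; apply: (@seq_form_exc_nondegenerate R W d What s) => [i|x _].
  by rewrite !seq_family_comp !refined_familyE subrr.
rewrite form_appB [X in _ - X](eq_form_app (g := fun y => kappa / (component_degree c1 *
    component_degree c2) * (component_degree c2 * component_divisor c1 y -
    component_degree c1 * component_divisor c2 y)) _ x); last first.
  by move=> y /=; field; rewrite !gt_eqF.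
rewrite form_appZ component_proportional mulr0 subr0.
rewrite -[RHS](@seq_form_total_transform R W d What s
  (fun l => fam2 c1 l - fam2 c2 l) _ x).
  by apply: eq_form_app => y; rewrite seq_familyB.
under eq_bigr do rewrite mulrBr.
by rewrite sumrB !refined_degree subrr.
Qed.

Lemma refined_local b i1 i2 :
    refined_colour i1 != refined_colour (br_comp b) ->
    refined_colour i2 != refined_colour (br_comp b) ->
  branch_inter (fam2 (refined_colour i1)) b =
  branch_inter (fam2 (refined_colour i2)) b.
Proof.
move=> n1 n2; rewrite -!(branch_inter_seq_family s) ?colour_family_neq //.
apply: eq_bigr => b' _; have [->//|mu0] := posnP (mu (seq_br s b) b').
congr (_ *+ _); apply/eqP; rewrite -subr_eq0; apply/eqP.
set y := br_comp b'; rewrite refined_multiplicity.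
suff D0 i : refined_colour i != refined_colour (br_comp b) ->
    component_divisor (refined_colour i) y = 0 by rewrite !D0 // !mulr0 subrr.
have [//|Ny] := component_divisor_supp (refined_colour i) y.
rewrite eq_sym /component_divisor => /negPf neq.
rewrite -(@fiber_component_adj (seq_comp s (br_comp b)) y) ?neq //.
rewrite /nontrivial_adj N_orig_gt0 Ny !andbT; apply/inter_num_gt0P.
by exists (seq_br s b), b'; rewrite br_comp_seq_br.
Qed.

Lemma refined_nontrivial i1 i2 x :
    0 < N x -> fiber_component x = refined_colour i1 ->
    refined_colour i2 != refined_colour i1 ->
  seq_family s (fam2 (refined_colour i1)) x !=
  seq_family s (fam2 (refined_colour i2)) x.
Proof.
move=> Nx cx neq; rewrite -subr_eq0 refined_multiplicity /component_divisor cx eqxx.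
rewrite [refined_colour i1 == _]eq_sym (negPf neq) mulr0 subr0 mulf_neq0 ?gt_eqF //.
by rewrite divr_gt0 // refined_degree_gt0.
Qed.

Lemma refined_chain i j : refined_colour i = refined_colour j ->
  exists c, [/\ path (@intersect What) (seq_comp s i) c,
    last (seq_comp s i) c = seq_comp s j &
    {in seq_comp s i :: c, forall x, 0 < N x /\ fiber_component x = refined_colour i}].
Proof.
move/eqP; rewrite (root_connect nontrivial_connect_sym) => /connectP[c + ->].
rewrite /refined_colour; have := N_orig_gt0 i; elim: c (seq_comp s i) => [|y c IH] x Nx /=.
  by exists [::]; split=> // z; rewrite inE => /eqP->.
move=> /andP[xy yc]; have [_ _ Ny] := and3P xy.
have [c' [c'P lastc' c'N]] := IH y Ny yc; exists (y :: c'); split=> //=.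
  rewrite c'P andbT; case/and3P: xy => /inter_num_gt0P[b1 [b2 [<- <- mu0]]] _ _.
  by apply/existsP; exists b1; apply/existsP; exists b2; rewrite !eqxx.
move=> z; rewrite inE => /predU1P[->//|/c'N[Nz ->]].
by rewrite (fiber_component_adj xy).
Qed.

End FiberComponents.

(** * Pencils and colourings *)

(** The coordinates of the family of a pencil are the differences between the
    multiplicities in the fiber number 0 and in the other fibers. *)
Lemma pencil_family_eq0 (R : rcfType) (W What : acc) (s : sigma_seq W What)
    (p : cpencil R W) x F G :
    seq_family s (pencil_family p) x = 0 -> F \in fibers p -> G \in fibers p ->
  seq_family s (fun i => (mult p i)%:R * (i \in F)%:R : R) x =
  seq_family s (fun i => (mult p i)%:R * (i \in G)%:R) x.
Proof.
move=> x0; pose n := #|fibers p|.-1; pose Fn j := nth set0 (enum (fibers p)) j.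
have ltn j : (j < n)%N -> (j.+1 < size (enum (fibers p)))%N.
  by rewrite -cardE /n; lia.
have n0 : (0 < size (enum (fibers p)))%N.
  by rewrite -cardE; apply: leq_trans (fibers_ge3 p).
have Fn_in j : (j < size (enum (fibers p)))%N -> Fn j \in fibers p.
  by move=> j_lt; rewrite -mem_enum mem_nth.
have coordE (j : 'I_n) i : pencil_family p i 0 j =
    (mult p i)%:R * ((i \in Fn j.+1)%:R - (i \in Fn 0)%:R).
  have coord (j' : 'I_n) c : (c *: delta_mx 0 j' : 'rV[rat]_n) 0 j = c * (j' == j)%:R.
    by rewrite !mxE eqxx /= eq_sym.
  rewrite /pencil_family -/(Fn 0%N); have [i0|i0] := boolP (i \in Fn 0).
    have -> : (i \in Fn j.+1) = false.
      apply/negbTE; apply: contraT => /negPn ij.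
      have tI := partition_trivIset (fibers_partition p).
      have := def_pblock tI (Fn_in _ n0) i0.
      rewrite (def_pblock tI (Fn_in _ (ltn j (ltn_ord j))) ij) => /eqP.
      by rewrite nth_uniq ?enum_uniq // ltn.
    rewrite mxE summxE (bigD1 j) //= mxE !eqxx big1 ?addr0.
      by rewrite sub0r mulrN !mulr1.
    by move=> j' j'j; rewrite mxE eqxx eq_sym (negPf j'j).
  rewrite summxE subr0; under eq_bigr do rewrite coord.
  rewrite big_mkcond (bigD1 j) //= -/(Fn j.+1) eqxx big1 ?addr0.
    by case: ifP; rewrite ?mulr1 ?mulr0.
  by move=> j' /negPf->; rewrite mulr0 if_same.
pose D (H : {set components W}) i : R := (mult p i)%:R * (i \in H)%:R.
have same j : (j < n)%N -> seq_family s (D (Fn j.+1)) x = seq_family s (D (Fn 0%N)) x.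
  move=> j_lt; pose g (v : 'rV[rat]_n) : R := ratr (v 0 (Ordinal j_lt)).
  have g0 : g 0 = 0 by rewrite /g mxE rmorph0.
  have gD : {morph g : u v / u + v} by move=> u v; rewrite /g mxE rmorphD.
  apply/eqP; rewrite -subr_eq0 -seq_familyB -g0 -x0 (seq_family_morph _ _ _ g0 gD).
  apply/eqP/eq_seq_family => i; rewrite /g coordE rmorphM rmorphB /= !ratr_nat.
  by rewrite -mulrBr.
suff to0 H : H \in fibers p -> seq_family s (D H) x = seq_family s (D (Fn 0%N)) x.
  by move=> Fp Gp; rewrite (to0 F Fp) (to0 G Gp).
rewrite -mem_enum => /(nthP set0)[[|j] j_lt <-] //; apply: same.
by rewrite /n ltn_predRL cardE.
Qed.

(** Multiplying [m i] by the [a l] with [l != i] gives integers proportional to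
    the [m i / a i]; it remains to divide by their common divisor. *)
Lemma coprime_rescaling (R : numFieldType) (I : finType) (i0 : I) (m a : I -> nat) :
    (forall i, (0 < m i)%N) -> (forall i, (0 < a i)%N) ->
  exists (m2 : I -> nat) (kappa : R),
    [/\ forall i, (0 < m2 i)%N, (\big[gcdn/0]_i m2 i = 1)%N, 0 < kappa &
        forall i, (m2 i)%:R * (a i)%:R = kappa * (m i)%:R].
Proof.
move=> m_gt0 a_gt0; pose m1 i := (m i * \prod_(l | l != i) a l)%N.
pose g := (\big[gcdn/0]_i m1 i)%N.
have m1_gt0 i : (0 < m1 i)%N by rewrite muln_gt0 m_gt0 prodn_gt0.
have g_dvd i : (g %| m1 i)%N by rewrite /g (bigD1 i) //= dvdn_gcdl.
have g_gt0 : (0 < g)%N by apply: dvdn_gt0 (m1_gt0 i0) (g_dvd i0).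
exists (fun i => m1 i %/ g)%N, ((\prod_l a l)%:R / g%:R); split=> [i|||i].
- by rewrite divn_gt0 // dvdn_leq.
- apply/eqP; rewrite -(eqn_pmul2l g_gt0) muln1.
  rewrite (big_morph (muln g) (muln_gcdr g) (muln0 g)) {2}/g.
  by apply/eqP; apply: eq_bigr => i _; rewrite mulnC divnK.
- by rewrite divr_gt0 // ltr0n // prodn_gt0.
have g_neq0 : g%:R != 0 :> R by rewrite pnatr_eq0 -lt0n.
apply: (mulfI g_neq0); rewrite mulrA -natrM mulnC divnK // -natrM.
rewrite /m1 -mulnA [(_ * a i)%N]mulnC (bigD1 (P := xpredT) i) //= natrM.
by field.
Qed.

Section Colouring.
Variables (R : rcfType) (W : acc).
Implicit Types p : cpencil R W.

Lemma pblock_fiber (p : cpencil R W) i : pblock (fibers p) i \in fibers p.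
Proof. by rewrite pblock_mem // (cover_partition (fibers_partition p)). Qed.

Definition pencil_colour (p : cpencil R W) (i : components W) : block (fibers p) :=
  exist _ (pblock (fibers p) i) (pblock_fiber p i).

Lemma pencil_colourE p (j : block (fibers p)) i :
  (i \in sval j) = (pencil_colour p i == j).
Proof.
have tI := partition_trivIset (fibers_partition p); apply/esym.
apply/eqP/idP => [<- /=|ij].
  by rewrite mem_pblock (cover_partition (fibers_partition p)).
by apply: val_inj => /=; apply: def_pblock (valP j) ij.
Qed.

Lemma pencil_colour_surj p (j : block (fibers p)) : exists i, pencil_colour p i = j.
Proof.
have /and3P[_ _ no0] := fibers_partition p.
have /set0Pn[i ij] : sval j != set0 by apply: contraNneq no0 => <-; apply: valP.
by exists i; apply/eqP; rewrite -pencil_colourE.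
Qed.

Lemma pencil_third p (j j' : block (fibers p)) : exists2 k, k != j & k != j'.
Proof.
have : ~~ (fibers p \subset [set sval j; sval j']).
  apply: contraTN (fibers_ge3 p) => /subset_leq_card; rewrite cards2 -ltnNge.
  by move/leq_ltn_trans; apply; case: (_ != _).
case/subsetPn => F Fp; rewrite !inE negb_or => /andP[Fj Fj'].
by exists (exist _ F Fp : block (fibers p)).
Qed.

Lemma fiber_interE (C : eqType) (m : components W -> nat) (col : components W -> C)
    (c : C) (F : {set components W}) b :
    (forall i, (i \in F) = (col i == c)) ->
  (fiber_inter m F b)%:R = branch_inter (colour_family R m col c) b.
Proof.
move=> FE; rewrite /fiber_inter big_mkcond natr_sum; apply: eq_bigr => b' _.
rewrite FE /colour_family; case: ifP => _; last by rewrite mulr0 mul0rn.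
by rewrite mulr1 natrM mulr_natr.
Qed.

Lemma sum_fiberE (C : eqType) (m : components W -> nat) (col : components W -> C)
    (c : C) (F : {set components W}) (d : components W -> R) :
    (forall i, (i \in F) = (col i == c)) ->
  \sum_(i in F) (m i)%:R * d i = \sum_i d i * colour_family R m col c i.
Proof.
move=> FE; rewrite big_mkcond; apply: eq_bigr => i _.
by rewrite FE /colour_family; case: ifP => _; rewrite ?mulr0 // mulr1 mulrC.
Qed.

Lemma pencil_degree p (j j' : block (fibers p)) :
  \sum_i degree R i * colour_family R (mult p) (pencil_colour p) j i =
  \sum_i degree R i * colour_family R (mult p) (pencil_colour p) j' i.
Proof.
rewrite -!(sum_fiberE _ _ (@pencil_colourE p _)).
by apply: fibers_degree; apply: valP.
Qed.

(** At a point whose components lie in one fiber, the other fibers do not meet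
    the branches at all. *)
Lemma pencil_local p b (j j' : block (fibers p)) :
    j != pencil_colour p (br_comp b) -> j' != pencil_colour p (br_comp b) ->
  branch_inter (colour_family R (mult p) (pencil_colour p) j) b =
  branch_inter (colour_family R (mult p) (pencil_colour p) j') b.
Proof.
move=> jb j'b; rewrite -!(fiber_interE _ _ (@pencil_colourE p _)); congr _%:R.
have bP : b \in branches_at (br_pt b) by rewrite inE.
have [[F Fp /subsetP sub]|[_ /(_ b bP) loc]] := fibers_local p (br_pt b); last first.
  by apply: loc; rewrite ?(valP j) ?(valP j') // pencil_colourE eq_sym.
suff none k : k != pencil_colour p (br_comp b) -> fiber_inter (mult p) (sval k) b = 0%N.
  by rewrite !none.
move=> kb; rewrite /fiber_inter big1 // => b' b'k.
have [->|mu0] := posnP (mu b b'); first by rewrite muln0.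
move: mu0; rewrite mu_gt0 => /andP[/eqP pt _]; case/eqP: kb.
have colF c : c \in branches_at (br_pt b) ->
    pencil_colour p (br_comp c) = exist _ F Fp.
  by move=> cP; apply/eqP; rewrite -pencil_colourE sub // imset_f.
rewrite (colF b bP) -(colF b') ?inE ?pt //.
by apply/esym/eqP; rewrite -pencil_colourE.
Qed.

Lemma preim_partitionE (C : eqType) (col : components W -> C) F :
    F \in preim_partition col [set: components W] ->
  exists i0, forall i, (i \in F) = (col i == col i0).
Proof. by case/imsetP => i0 _ ->; exists i0 => i; rewrite !inE eq_sym. Qed.

Lemma preim_partition_class (C : eqType) (col : components W -> C) i0 :
  [set i | col i == col i0] \in preim_partition col [set: components W].
Proof.
by apply/imsetP; exists i0 => //; apply/setP => i; rewrite !inE eq_sym.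
Qed.

Lemma pencil_of_colouring (C : eqType) (m : components W -> nat)
    (col : components W -> C) :
    (forall i, (0 < m i)%N) ->
    (exists i1 i2 i3, [/\ col i1 != col i2, col i2 != col i3 & col i3 != col i1]) ->
    (forall i i', \sum_l degree R l * colour_family R m col (col i) l =
                  \sum_l degree R l * colour_family R m col (col i') l) ->
    (forall b i i', col i != col (br_comp b) -> col i' != col (br_comp b) ->
       branch_inter (colour_family R m col (col i)) b =
       branch_inter (colour_family R m col (col i')) b) ->
  exists p : cpencil R W,
    fibers p = preim_partition col [set: components W] /\ mult p = m.
Proof.
move=> m_gt0 [i1 [i2 [i3 [n12 n23 n31]]]] deg loc.
set FF := preim_partition col _.
have FF3 : (3 <= #|FF|)%N.
  pose cl i := [set l | col l == col i].
  have clP i i' : col i != col i' -> cl i != cl i'.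
    apply: contra_neq => /setP/(_ i); rewrite !inE eqxx.
    by move/esym/eqP.
  by apply/card_gt2P; exists (cl i1), (cl i2), (cl i3);
    rewrite !preim_partition_class !clP.
have degF F G : F \in FF -> G \in FF ->
    \sum_(i in F) (m i)%:R * degree R i = \sum_(i in G) (m i)%:R * degree R i.
  move=> /preim_partitionE[i FE] /preim_partitionE[i' GE].
  by rewrite (sum_fiberE _ _ FE) (sum_fiberE _ _ GE).
have locF (P : points W) :
    (exists2 F, F \in FF & [set br_comp b | b in branches_at P] \subset F) \/
    ((forall F, F \in FF -> ~~ ([set br_comp b | b in branches_at P] \subset F)) /\
     (forall b, b \in branches_at P -> forall F G, F \in FF -> G \in FF ->
        br_comp b \notin F -> br_comp b \notin G ->
        fiber_inter m F b = fiber_inter m G b)).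
  have [/exists_inP[F FFF sub]|none] :=
    boolP [exists F in FF, [set br_comp b | b in branches_at P] \subset F].
    by left; exists F.
  right; split=> [|b _ F G /preim_partitionE[i FE] /preim_partitionE[i' GE]].
    by move/exists_inPn: none.
  rewrite FE GE (eq_sym _ (col i)) (eq_sym _ (col i')) => bF bG.
  apply/eqP; rewrite -(eqr_nat R).
  by rewrite (fiber_interE _ _ FE) (fiber_interE _ _ GE) (loc b i i').
by exists (CPencil (preim_partitionP _ _) FF3 m_gt0 degF locF).
Qed.

End Colouring.

Section ThirdComponent.
Variables (R : rcfType) (W : acc) (p : cpencil R W).
Implicit Types i j k : components W.

Lemma third_component i j : i != j -> exists k, uniq [:: i; j; k].
Proof.
move=> ij; have [b bi bj] := pencil_third (pencil_colour p i) (pencil_colour p j).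
have [k kb] := pencil_colour_surj b; exists k.
rewrite /= !inE negb_or ij andbT /=; apply/andP; split.
  by apply: contraNneq bi => ->; rewrite kb.
by apply: contraNneq bj => ->; rewrite kb.
Qed.

Lemma two_other_components i : exists j k, uniq [:: i; j; k].
Proof.
have [b bi _] := pencil_third (pencil_colour p i) (pencil_colour p i).
have [j jb] := pencil_colour_surj b.
have ij : i != j by apply: contraNneq bi => ->; rewrite jb.
by have [k ijk] := third_component ij; exists j, k.
Qed.

Lemma three_colours : exists i1 i2 i3,
  [/\ pencil_colour p i1 != pencil_colour p i2,
      pencil_colour p i2 != pencil_colour p i3 &
      pencil_colour p i3 != pencil_colour p i1].
Proof.
have [F [_ [_ [[Fp _ _] _]]]] := card_gt2P (fibers_ge3 p).
have [i1 _] := pencil_colour_surj (exist _ F Fp : block (fibers p)).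
have [b bi1 _] := pencil_third (pencil_colour p i1) (pencil_colour p i1).
have [i2 i2b] := pencil_colour_surj b.
have [c ci1 ci2] := pencil_third (pencil_colour p i1) (pencil_colour p i2).
have [i3 i3c] := pencil_colour_surj c.
by exists i1, i2, i3; split; [rewrite eq_sym i2b|rewrite eq_sym i3c|rewrite i3c].
Qed.

End ThirdComponent.

Theorem theorem3p18 (R : rcfType) (W : acc) (solvW : solvable W)
    (bezW : bezout W) (What : acc) (pi : sigma_seq W What)
    (resPi : is_resolution pi) (P1 : cpencil R W) :
  exists P2 : cpencil R W, refinement P2 P1 /\ primitive pi P2.
Proof.
pose d := @degree R W; pose m := mult P1; pose col := pencil_colour P1.
have d_gt0 i : 0 < d i.
  by have [j [k ijk]] := two_other_components P1 i; apply: degree_pos ijk.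
have dM i j : i != j -> d i * d j = (inter_num i j)%:R.
  by move=> /(third_component P1)[k ijk]; apply: degree_mul ijk.
have [i1 [i2 [i3 [n12 n23 n31]]]] := three_colours P1.
have m_gt0 : forall i, (0 < m i)%N := @mult_gt0 _ _ P1.
have [top [N [N_ge0 NE top_eq top_orig N_orig]]] :=
  exists_fiber_divisors resPi dM (col i1) (@pencil_third R W P1) m_gt0
    (@pencil_degree R W P1) (@pencil_local R W P1).
have fibers_equiv i k x : form_app (seq_form pi d)
    (fun y => N y * ((top y == i)%:R - (top y == k)%:R)) x = 0.
  rewrite -(difference_orthogonal pi (@pencil_degree R W P1) i k x).
  by apply: eq_form_app => y; rewrite NE.
have J2 (j : block (fibers P1)) : exists k, k != j.
  by have [k] := pencil_third j j; exists k.
pose col2 := refined_colour pi N.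
have deg_gt0 i : 0 < component_degree pi d N (col2 i).
  by apply: (refined_degree_gt0 d_gt0 dM J2 N_ge0 top_eq fibers_equiv m_gt0 N_orig).
(* The degrees of the new fibers, in a common unit 1 / K. *)
have [K K_gt0 [a aE]] : exists2 K : R, 0 < K &
    exists a : components W -> nat, forall l, d l * K = (a l)%:R.
  have [j [k ijk]] := two_other_components P1 i1.
  exact: degree_scale ijk d_gt0 dM.
pose A i := (\sum_(l | col2 l == col2 i) m l * a l)%N.
have AE i : component_degree pi d N (col2 i) * K = (A i)%:R.
  rewrite /component_degree mulr_suml natr_sum [RHS]big_mkcond /=; apply: eq_bigr => l _.
  rewrite /component_divisor -/(col2 l); case: ifP => _; last by rewrite mulr0 mul0r.
  by rewrite N_orig mulrAC aE mulrC natrM.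
have A_gt0 i : (0 < A i)%N by rewrite -(ltr0n R) -AE mulr_gt0.
have [m2 [kappa [m2_gt0 gcd1 kappa_gt0 m2E]]] := coprime_rescaling R i1 m_gt0 A_gt0.
have {}m2E i : (m2 i)%:R * component_degree pi d N (col2 i) = kappa / K * (m i)%:R.
  have K_neq0 := lt0r_neq0 K_gt0.
  by apply: (mulIf K_neq0); rewrite -[LHS]mulrA AE m2E; field.
have {}kappa_gt0 : 0 < kappa / K by rewrite divr_gt0.
have col2_col i j : col2 i = col2 j -> col i = col j.
  by move/(fiber_component_top top_eq); rewrite !top_orig.
have col2_neq i j : col i != col j -> col2 i != col2 j.
  by apply: contra_neq; apply: col2_col.
have [] := @pencil_of_colouring R W _ m2 col2 m2_gt0.
- by exists i1, i2, i3; rewrite !col2_neq.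
- move=> i j.
  by rewrite !(refined_degree d_gt0 dM J2 N_ge0 top_eq fibers_equiv m_gt0 N_orig m2E).
- move=> b i j.
  exact: (refined_local d_gt0 dM J2 N_ge0 top_eq fibers_equiv m_gt0 N_orig m2E).
move=> P2 [fib2 mult2]; exists P2; split.
  move=> F2; rewrite fib2 => /preim_partitionE[i0 F2E].
  exists (sval (col i0)); first exact: valP.
  by apply/subsetP => i; rewrite F2E pencil_colourE => /eqP/col2_col/eqP.
split; last by rewrite mult2.
move=> F i j; rewrite fib2 => /preim_partitionE[i0 FE].
rewrite !FE => /eqP ii0 /eqP ji0.
have [c [c_path c_last cN]] := refined_chain m_gt0 N_orig (etrans ii0 (esym ji0)).
exists c; split=> //; apply/allP => x /cN[Nx cx]; rewrite /trivial_exceptional.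
have [i' neq] : exists i', col2 i' != col2 i.
  have [b bi] := J2 (col i); have [i' i'b] := pencil_colour_surj b.
  by exists i'; apply: col2_neq; rewrite /col i'b.
apply: contra (refined_nontrivial d_gt0 dM J2 N_ge0 top_eq fibers_equiv m_gt0
  kappa_gt0 N_orig m2E Nx cx neq) => /andP[_ /eqP triv].
have cls k : [set l | col2 l == col2 k] \in fibers P2.
  by rewrite fib2; apply: preim_partition_class.
have e := pencil_family_eq0 triv (cls i) (cls i').
have famE k : seq_family pi (colour_family R m2 col2 (col2 k)) x =
    seq_family pi (fun l => (mult P2 l)%:R * (l \in [set l | col2 l == col2 k])%:R) x.
  by apply: eq_seq_family => l; rewrite inE mult2.
by rewrite !famE e.
Qed.
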